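(* Let $a_0,a_1,b_0,b_1,c_0,c_1,d_0,d_1,e_0,e_1,z_0,z_1$ be non-negative integers such that for $i=0,1$: $b_i+c_i=e_i+z_i$, $a_i+b_i=d_i+e_i$, $c_i+d_i=z_i+a_i$; put $a=a_0+a_1$, and similarly $b,c,d,e,z$. Let $\alpha\in\binom{[a]}{a_1}$, $\beta\in\binom{[b]}{b_1}$, $\gamma\in\binom{[c]}{c_1}$, $\delta\in\binom{[d]}{d_1}$, $\epsilon\in\binom{[e]}{e_1}$, $\zeta\in\binom{[z]}{z_1}$. Then $$c_{\mathrm{sort}(\alpha)\beta\gamma,\ \mathrm{sort}(\gamma)\,\delta\,\mathrm{sort}(\epsilon)}^{(\epsilon\zeta\alpha)^\vee}=c_{\mathrm{sort}(\delta)\epsilon\zeta,\ \mathrm{sort}(\zeta)\,\alpha\,\mathrm{sort}(\beta)}^{(\beta\gamma\delta)^\vee}.$$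
   Context: Strings: $\binom{[n]}{k}$ denotes the set of binary strings (words in $0,1$) of length $n$ with exactly $k$ ones; juxtaposition is concatenation; $\lambda^\vee$ is the reversal of $\lambda$; $\mathrm{sort}(\lambda)=0^{n-k}1^k$ for $\lambda\in\binom{[n]}{k}$. Littlewood-Richardson numbers: for $\lambda,\mu,\nu\in\binom{[n]}{k}$, $c_{\lambda,\mu}^\nu$ is defined by $[X_\lambda][X_\mu]=\sum_{\nu\in\binom{[n]}{k}}c_{\lambda,\mu}^\nu[X_\nu]$ in $H^*(\mathrm{Gr}(k;\mathbb{C}^n))$, where $X_\lambda=\{V:\dim(V\cap\langle e_1,\dots,e_i\rangle)\ge\lambda_1+\dots+\lambda_i\ \forall i\}$ is a Schubert variety. Equivalently it is the usual Littlewood-Richardson coefficient of the partitions attached to the strings, the partition of $\lambda$ having as its $j$-th part the number of $0$s to the right of the $j$-th $1$ in $\lambda$. *)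

(* Defs.v *)
From mathcomp Require Import all_boot all_order all_algebra.
From mathcomp Require Import mpoly.
From Stdlib Require Import ClassicalEpsilon.

Set Implicit Arguments.
Unset Strict Implicit.
Unset Printing Implicit Defensive.

Import GRing.Theory.
Local Open Scope ring_scope.

(* Binary strings are boolean sequences, [true] being the letter 1. *)
Definition strings (n k : nat) : pred (seq bool) :=
  [pred s | (size s == n) && (count_mem true s == k)].

Definition sort01 (s : seq bool) : seq bool :=
  nseq (count_mem false s) false ++ nseq (count_mem true s) true.

(* One part for each 1 of the string, namely the number of 0s to its right;
   trailing zero parts are kept, so a string with k ones has exactly k parts. *)
Fixpoint shape_of (s : seq bool) : seq nat :=
  if s is x :: s' then
    if x then count_mem false s' :: shape_of s' else shape_of s'
  else [::].

(* Boxes of the Young diagram: row [tag x], column [tagged x]. *)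
Definition box (sh : seq nat) : Type := {i : 'I_(size sh) & 'I_(nth 0%N sh i)}.

Definition row_of (sh : seq nat) (x : box sh) : nat := tag x.
Definition col_of (sh : seq nat) (x : box sh) : nat := tagged x.

Definition semistandard (k : nat) (sh : seq nat)
    (T : {ffun box sh -> 'I_k}) : bool :=
  [forall x, forall y,
    ((row_of x == row_of y) && (col_of x <= col_of y) ==> (T x <= T y))
    && ((row_of x < row_of y) && (col_of x == col_of y) ==> (T x < T y))]%N.

Definition schur (k : nat) (sh : seq nat) : {mpoly int[k]} :=
  \sum_(T : {ffun box sh -> 'I_k} | semistandard T) \prod_(x : box sh) 'X_(T x).

(* The partitions of N with at most k parts, padded with zeros to length k. *)
Definition partitions (k N : nat) : seq (seq nat) :=
  [seq p <- [seq [seq val i | i <- val t] | t <- enum {: k.-tuple 'I_N.+1}]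
  | sorted geq p && (sumn p == N)].

(* The Schur polynomials in k variables indexed by [partitions k N] are linearly
   independent, so the two conditions below determine [c] completely. *)
Definition schur_product_expansion (k : nat) (la mu : seq nat)
    (c : seq nat -> int) : Prop :=
  let N := (sumn la + sumn mu)%N in
  (forall nu, nu \notin partitions k N -> c nu = 0) /\
  schur k la * schur k mu = \sum_(nu <- partitions k N) c nu *: schur k nu.

Definition LRcoef (k : nat) (la mu nu : seq nat) : int :=
  epsilon (inhabits (fun _ : seq nat => 0)) (schur_product_expansion k la mu) nu.

(* Meaningful for three strings of the same length with equally many ones. *)
Definition LR (la mu nu : seq bool) : int :=
  LRcoef (count_mem true la) (shape_of la) (shape_of mu) (shape_of nu).

(* Main.v *)
Require Import Defs.
From mathcomp Require Import all_boot all_order all_algebra.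
From mathcomp Require Import ring zify mpoly.
From Stdlib Require Import ClassicalEpsilon.

Set Implicit Arguments.
Unset Strict Implicit.
Unset Printing Implicit Defensive.

Import GRing.Theory.
Local Open Scope ring_scope.

(* Knutson-Tao puzzles compute the coefficients: [LR la mu nu] is the number of
   puzzles with sides la (left), mu (right), nu (bottom).  When the three corner
   strings are sorted the corners of the big triangle are forced, what remains
   is a hexagon with clockwise sides alpha, beta, gamma, delta, eps, zeta, and
   rotating the hexagon by 180 degrees maps puzzles to puzzles.

   The puzzle rule itself comes from integrability: a line carrying a state can
   be moved through a puzzle, across the left side (where it acts trivially),
   from the right side (where it adds a vertical strip to mu) to the bottom
   side (where it adds one to nu).  Hence mu |-> sum_nu #puzzles(la, mu, nu) s_nu
   commutes with multiplication by elementary symmetric polynomials, as does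
   mu |-> s_la s_mu by Pieri's rule; both agree at the empty partition, hence
   everywhere.  Pieri's rule follows from a commutation of the same kind between
   adding a vertical strip and removing the largest entry of a tableau. *)

(** The passage from the empty partition to all others is delicate: strings of length n only see
    shapes inside the rectangle with k rows and n - k columns, and Pieri's rule leads out of it. An
    unsorted [mu] is written v01^m. It is the lexicographically leading term, with coefficient 1, of
    an elementary symmetric polynomial times the Schur polynomial of the smaller string 0v1^m. As
    that string begins with 0, no term of this product leaves the rectangle. On the side of [nu]
    terms do leave it, so the induction proves the product formula only modulo the span of the Schur
    polynomials of such shapes ([far]). This span is stable under multiplication by elementary
    symmetric polynomials, and linear independence lets the coefficients inside the rectangle be
    read off at the end. All degrees are treated at once: the exponent of u is the number of letters
    minus the number of added boxes, so the coefficients of one polynomial identity cover every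
    elementary symmetric polynomial. *)

Fixpoint words (A : finType) (n : nat) : seq (seq A) :=
  if n is n'.+1 then [seq a :: w | a <- enum A, w <- words A n'] else [:: [::]].

Arguments words : simpl never.

Lemma mem_words (A : finType) n (w : seq A) : (w \in words A n) = (size w == n).
Proof.
elim: n w => [|n IH] w; first by rewrite inE -size_eq0.
apply/allpairsP/idP => [[[a v] /= [_ Hv ->]]|].
  by rewrite /= eqSS -IH.
by case: w => // a v; rewrite eqSS -IH => Hv; exists (a, v); rewrite mem_enum.
Qed.

Lemma words_uniq (A : finType) n : uniq (words A n).
Proof.
elim: n => // n IH; apply: allpairs_uniq => //; first exact: enum_uniq.
by move=> [a v] [b w] _ _ /= [-> ->].
Qed.

Section BigWords.
Variables (A : finType) (R : Type) (idx : R) (op : Monoid.com_law idx).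

Lemma big_words0 (F : seq A -> R) : \big[op/idx]_(w <- words A 0) F w = F [::].
Proof. by rewrite big_seq1. Qed.

Lemma big_wordsS n (F : seq A -> R) :
  \big[op/idx]_(w <- words A n.+1) F w
  = \big[op/idx]_a \big[op/idx]_(w <- words A n) F (a :: w).
Proof. by rewrite /words big_allpairs_dep big_enum. Qed.

Lemma big_words_cat m n (F : seq A -> R) :
  \big[op/idx]_(w <- words A (m + n)) F w
  = \big[op/idx]_(v <- words A m) \big[op/idx]_(w <- words A n) F (v ++ w).
Proof.
elim: m F => [|m IH] F; first by rewrite big_words0.
rewrite addSn !big_wordsS; apply: eq_bigr => a _; exact: IH.
Qed.

Lemma big_words1 n (v : seq A) (F : seq A -> R) : size v = n ->
  (forall w, size w = n -> w != v -> F w = idx) ->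
  \big[op/idx]_(w <- words A n) F w = F v.
Proof.
move=> sv F0; rewrite (bigD1_seq v) ?words_uniq ?mem_words ?sv //=.
rewrite big_seq_cond big1 ?Monoid.mulm1 // => w /andP[].
by rewrite mem_words => /eqP /F0.
Qed.

Lemma big_words_rev n (F : seq A -> R) :
  \big[op/idx]_(w <- words A n) F (rev w) = \big[op/idx]_(w <- words A n) F w.
Proof.
rewrite [RHS](perm_big [seq rev w | w <- words A n]) ?big_map //=.
apply: uniq_perm; rewrite ?map_inj_uniq ?words_uniq //; first exact: (can_inj revK).
move=> w; rewrite mem_words; apply/eqP/mapP => [sw|[v]].
  by exists (rev w); rewrite ?revK // mem_words size_rev sw.
by rewrite mem_words => /eqP sv ->; rewrite size_rev.
Qed.

Lemma big_label (F : option bool -> R) :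
  \big[op/idx]_x F x = op (F None) (op (F (Some true)) (F (Some false))).
Proof.
rewrite (bigD1 None) //= (bigD1 (Some true)) //= (bigD1 (Some false)) //=.
by rewrite big1 ?Monoid.mulm1 // => -[[]|].
Qed.

End BigWords.

(** * Moving a line through puzzles *)

Section WordOperator.
Variables (R : pzSemiRingType) (S : finType) (A : eqType).
Variable (L : S -> A -> A -> S -> R).

(** The entry (s, t) of a transfer matrix: a state runs along the word and each letter is rewritten
    with a weight depending on the states before and after it. *)
Fixpoint word_op (s : S) (w w' : seq A) (t : S) : R :=
  match w, w' with
  | [::], [::] => (s == t)%:R
  | a :: v, b :: v' => \sum_r L s a b r * word_op r v v' t
  | _, _ => 0
  end.

End WordOperator.

(* The puzzle labels 0, 1 and 10 are [Some false], [Some true] and [None]. *)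
Local Notation label := (option bool).

(* An upward triangle with left side x, right side z and bottom y.  Pieces may be
   rotated by 180 degrees, so this is also the condition on a downward triangle
   with right side x, left side z and top y. *)
Definition piece (x z y : label) : bool :=
  match x, z, y with
  | Some a, Some b, Some c => (a == b) && (b == c)
  | None, Some true, Some false => true
  | Some true, Some false, None => true
  | Some false, None, Some true => true
  | _, _, _ => false
  end.

(* [cross* s a b t]: weight of the line entering an edge in state s and leaving it
   in state t while the label changes from a to b, for edges / (L), \ (R), - (D).
   The weights were found by computer as a solution of [cross_up] and
   [cross_down] that is trivial on L and adds vertical strips on R and D. *)
Section Line.
Variables (R : comNzRingType) (u : R).

Definition crossL (s a b t : label) : R :=
  match s, a, b, t with
  | Some false, Some false, Some false, Some false => 1
  | Some false, Some true, Some true, Some false => 1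
  | Some false, None, Some false, Some true => 1
  | Some true, Some false, Some false, Some true => - u
  | Some true, Some false, Some true, None => 1
  | Some true, Some false, None, Some false => u
  | Some true, Some true, Some true, Some true => 1
  | Some true, None, None, Some true => u
  | None, Some false, Some false, None => 1
  | None, Some true, Some false, Some true => 1
  | _, _, _, _ => 0
  end.

Definition crossR (s a b t : label) : R :=
  match s, a, b, t with
  | Some false, Some false, Some false, Some false => u
  | Some false, Some false, Some true, Some true => 1
  | Some false, Some false, None, None => 1
  | Some false, Some true, Some true, Some false => u
  | Some false, None, None, Some false => u
  | Some true, Some true, Some false, Some false => u
  | Some true, Some true, Some true, Some true => 1
  | Some true, Some true, None, None => 1
  | None, Some true, Some true, None => u
  | None, None, Some false, Some false => u
  | None, None, Some true, Some true => 1
  | None, None, None, None => 1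
  | _, _, _, _ => 0
  end.

Definition crossD (s a b t : label) : R :=
  match s, a, b, t with
  | Some false, Some false, Some false, Some false => u
  | Some false, Some false, Some true, None => 1
  | Some false, Some true, Some true, Some false => u
  | Some false, None, Some true, Some true => 1
  | Some false, None, None, Some false => u
  | Some true, Some false, Some false, Some true => u
  | Some true, Some true, Some true, Some true => 1
  | Some true, Some true, None, Some false => u
  | None, Some true, Some false, Some false => u
  | None, Some true, Some true, None => 1
  | _, _, _, _ => 0
  end.

(** A local exchange relation of Yang-Baxter type: a line passing above an upward triangle is pulled
    down across its bottom edge. Five boundary labels stay free, so this is a check of 3^5
    identities. *)
Lemma cross_up (s x0 z0 y t : label) :
  \sum_s1 \sum_x \sum_z crossL s x0 x s1 * crossR s1 z0 z t * (piece x z y)%:R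
  = \sum_y0 (piece x0 z0 y0)%:R * crossD s y0 y t.
Proof.
rewrite !big_label.
by case: s => [[]|]; case: t => [[]|]; case: x0 => [[]|]; case: z0 => [[]|];
  case: y => [[]|]; rewrite /=; ring.
Qed.

Lemma cross_down (s z w y0 t : label) :
  \sum_y crossD s y0 y t * (piece w z y)%:R
  = \sum_z0 \sum_w0 \sum_s1
      (piece w0 z0 y0)%:R * (crossR s z0 z s1 * crossL s1 w0 w t).
Proof.
rewrite !big_label.
by case: s => [[]|]; case: t => [[]|]; case: w => [[]|]; case: z => [[]|];
  case: y0 => [[]|]; rewrite /=; ring.
Qed.
End Line.

(* Number of fillings of the strip between two neighbouring \ lines, which carry
   the words u (left) and v (right), read from top to bottom.  The strip starts
   with a / edge x ([slash]) or a - edge c ([dash]), and ends with a / edge if k'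
   holds and a - edge otherwise, with label y. *)
Fixpoint slash (k' : bool) (y x : label) (u v : seq label) {struct v} : nat :=
  match v with
  | [::] => [&& u == [::], k' & x == y]
  | z :: v1 => \sum_c piece x z c *
      match u with
      | [::] => [&& v1 == [::], ~~ k' & c == y]
      | z1 :: u1 => \sum_w piece w z1 c * slash k' y w u1 v1
      end
  end%N.

Definition dash (k' : bool) (y c : label) (u v : seq label) : nat :=
  match u with
  | [::] => [&& v == [::], ~~ k' & c == y]
  | z1 :: u1 => \sum_w piece w z1 c * slash k' y w u1 v
  end%N.

Lemma slash_cons k' y x u z v :
  slash k' y x u (z :: v) = (\sum_c piece x z c * dash k' y c u v)%N.
Proof. by []. Qed.

Lemma dash_cons k' y c z u v :
  dash k' y c (z :: u) v = (\sum_w piece w z c * slash k' y w u v)%N.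
Proof. by []. Qed.

Lemma dash0 y c : dash false y c [::] [::] = (c == y).
Proof. by []. Qed.

Lemma big_pick (R : pzSemiRingType) (I : finType) (i0 : I) (F : I -> R) :
  \sum_i F i * (i == i0)%:R = F i0.
Proof.
rewrite (bigD1 i0) //= eqxx mulr1 big1 ?addr0 // => i /negPf ->.
by rewrite mulr0.
Qed.

Lemma exchange_big4 (R : nmodType) (I : finType) (F : I -> I -> I -> I -> R) :
  \sum_a \sum_b \sum_c \sum_d F a b c d = \sum_d \sum_c \sum_b \sum_a F a b c d.
Proof.
under eq_bigr => a _ do under eq_bigr => b _ do rewrite exchange_big /=.
under eq_bigr => a _ do rewrite exchange_big /=.
rewrite exchange_big /=; apply: eq_bigr => d _.
under eq_bigr => a _ do rewrite exchange_big /=.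
rewrite exchange_big /=; apply: eq_bigr => c _.
by rewrite exchange_big.
Qed.

Section Train.
Variables (R : comNzRingType) (u : R).
Let LA := crossL u.
Let LB := crossR u.
Let LC := crossD u.

Lemma word_op_cons (S : finType) (A : eqType) (L : S -> A -> A -> S -> R) s a v b w t :
  word_op L s (a :: v) (b :: w) t = \sum_r L s a b r * word_op L r v w t.
Proof. by []. Qed.

Lemma word_op1 (S : finType) (A : eqType) (L : S -> A -> A -> S -> R) s a b t :
  word_op L s [:: a] [:: b] t = L s a b t.
Proof. by rewrite /= big_pick. Qed.

Definition cross_before t y s x l v0 :=
  \sum_(v <- words label (size v0)) word_op LB s v0 v t * (slash false y x l v)%:R.
Definition cross_after t y s x l v0 :=
  \sum_s2 \sum_y0 \sum_(l0 <- words label (size l))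
     (slash false y0 x l0 v0)%:R * word_op LB s l0 l s2 * LC s2 y0 y t.

Lemma cross_before_cons t y s x z l z0 v0 : cross_before t y s x (z :: l) (z0 :: v0) =
 \sum_s2 \sum_w (\sum_c \sum_zz LB s z0 zz s2 * (piece x zz c)%:R * (piece w z c)%:R) *
   cross_before t y s2 w l v0.
Proof.
rewrite /cross_before -[size (_ :: _)]/(size v0).+1 big_wordsS.
transitivity (\sum_zz \sum_s2 \sum_w \sum_c
  LB s z0 zz s2 * (piece x zz c)%:R * (piece w z c)%:R * cross_before t y s2 w l v0).
  apply: eq_bigr => zz _; rewrite /cross_before.
  under eq_bigr => v _ do rewrite word_op_cons mulr_suml.
  rewrite exchange_big; apply: eq_bigr => s2 _ /=.
  under eq_bigr => v _ do rewrite natr_sum mulr_sumr.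
  rewrite exchange_big /= [RHS]exchange_big /=; apply: eq_bigr => c _.
  under [RHS]eq_bigr => w _ do rewrite mulr_sumr.
  rewrite exchange_big /=; apply: eq_bigr => v _.
  rewrite natrM natr_sum !mulr_sumr; apply: eq_bigr => w _.
  by rewrite natrM; ring.
rewrite exchange_big; apply: eq_bigr => s2 _ /=.
rewrite exchange_big; apply: eq_bigr => w _ /=.
rewrite exchange_big mulr_suml; apply: eq_bigr => c _ /=.
by rewrite mulr_suml.
Qed.

Lemma cross_after_cons t y s x z l z0 v0 : cross_after t y s x (z :: l) (z0 :: v0) =
 \sum_s2 \sum_w (\sum_c \sum_zz (piece x z0 c)%:R * (piece w zz c)%:R * LB s zz z s2) *
   cross_after t y s2 w l v0.
Proof.
transitivity (\sum_s2 \sum_w \sum_c \sum_zz  \sum_r \sum_y0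
  \sum_(l0 <- words label (size l))
   (piece x z0 c)%:R * (piece w zz c)%:R * LB s zz z s2 * ((slash false y0 w l0 v0)%:R *
     word_op LB s2 l0 l r * LC r y0 y t)); last first.
  apply: eq_bigr => s2 _; apply: eq_bigr => w _.
  rewrite mulr_suml; apply: eq_bigr => c _.
  rewrite mulr_suml; apply: eq_bigr => zz _.
  rewrite mulr_sumr; apply: eq_bigr => r _.
  rewrite mulr_sumr; apply: eq_bigr => y0 _.
  by rewrite mulr_sumr.
transitivity (\sum_r \sum_y0 \sum_zz \sum_(l0 <- words label (size l)) \sum_c \sum_w
  \sum_s2
   (piece x z0 c)%:R * (piece w zz c)%:R * LB s zz z s2 * ((slash false y0 w l0 v0)%:R *
     word_op LB s2 l0 l r * LC r y0 y t)).
  apply: eq_bigr => r _; apply: eq_bigr => y0 _; rewrite big_wordsS.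
  apply: eq_bigr => zz _; apply: eq_bigr => l0 _.
  rewrite slash_cons word_op_cons natr_sum -mulrA [LHS]mulr_suml; apply: eq_bigr => c _.
  rewrite natrM dash_cons natr_sum mulr_sumr [LHS]mulr_suml; apply: eq_bigr => w _.
  rewrite natrM mulr_suml [LHS]mulr_sumr; apply: eq_bigr => s2 _.
  by ring.
rewrite [RHS]exchange_big4.
under [LHS]eq_bigr => r _ do rewrite exchange_big /=.
rewrite [LHS]exchange_big /=; apply: eq_bigr => zz _.
transitivity (\sum_r \sum_y0 \sum_c \sum_w \sum_s2 \sum_(l0 <- words label (size l))
   (piece x z0 c)%:R * (piece w zz c)%:R * LB s zz z s2 * ((slash false y0 w l0 v0)%:R *
     word_op LB s2 l0 l r * LC r y0 y t)).
  apply: eq_bigr => r _; apply: eq_bigr => y0 _.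
  rewrite exchange_big /=; apply: eq_bigr => c _.
  rewrite exchange_big /=; apply: eq_bigr => w _.
  by rewrite exchange_big.
under [LHS]eq_bigr => r _ do rewrite exchange_big /=.
rewrite [LHS]exchange_big /=; apply: eq_bigr => c _.
under [LHS]eq_bigr => r _ do rewrite exchange_big /=.
rewrite [LHS]exchange_big /=; apply: eq_bigr => w _.
under [LHS]eq_bigr => r _ do rewrite exchange_big /=.
by rewrite [LHS]exchange_big /=; apply: eq_bigr => s2 _.
Qed.

(** In a rhombus made of an upward and a downward triangle the line is moved first by [cross_up] and
    then by [cross_down]; in between it crosses the horizontal edge that the two triangles share. *)
Lemma cross_commute s x0 z0 z s2 w :
  \sum_s1 \sum_x LA s x0 x s1 *
     (\sum_c \sum_zz LB s1 z0 zz s2 * (piece x zz c)%:R * (piece w z c)%:R)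
  = \sum_s3 \sum_w0 (\sum_c0 \sum_zz (piece x0 z0 c0)%:R * (piece w0 zz c0)%:R * LB s zz z
    s3)
      * LA s3 w0 w s2.
Proof.
transitivity (\sum_c (\sum_y0 (piece x0 z0 y0)%:R * LC s y0 c s2) * (piece w z c)%:R).
  transitivity (\sum_s1 \sum_c \sum_x \sum_zz LA s x0 x s1 * LB s1 z0 zz s2 *
    (piece x zz c)%:R * (piece w z c)%:R).
    apply: eq_bigr => s1 _; rewrite [RHS]exchange_big; apply: eq_bigr => x _ /=.
    rewrite mulr_sumr; apply: eq_bigr => c _.
    by rewrite mulr_sumr; apply: eq_bigr => zz _; rewrite !mulrA.
  rewrite exchange_big; apply: eq_bigr => c _; rewrite -cross_up /= mulr_suml.
  apply: eq_bigr => s1 _; rewrite mulr_suml; apply: eq_bigr => x _.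
  by rewrite mulr_suml.
transitivity (\sum_c0 (piece x0 z0 c0)%:R * (\sum_zz \sum_w0 \sum_s3
  (piece w0 zz c0)%:R * (LB s zz z s3 * LA s3 w0 w s2))).
  under [RHS]eq_bigr => c0 _ do rewrite -cross_down mulr_sumr.
  rewrite [RHS]exchange_big; apply: eq_bigr => c _; rewrite mulr_suml.
  by apply: eq_bigr => y0 _; rewrite mulrA.
symmetry;
  transitivity (\sum_c0 \sum_s3 \sum_w0 \sum_zz (piece x0 z0 c0)%:R * (piece w0 zz c0)%:R
  * LB s zz z s3 * LA s3 w0 w s2).
  rewrite [RHS]exchange_big; apply: eq_bigr => s3 _ /=.
  rewrite [RHS]exchange_big; apply: eq_bigr => w0 _ /=.
  rewrite mulr_suml; apply: eq_bigr => c0 _.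
  by rewrite mulr_suml.
apply: eq_bigr => c0 _; rewrite mulr_sumr.
rewrite exchange_big /=; under eq_bigr => w0 _ do rewrite exchange_big /=.
rewrite exchange_big; apply: eq_bigr => zz _ /=.
rewrite mulr_sumr; apply: eq_bigr => w0 _.
rewrite mulr_sumr; apply: eq_bigr => s3 _.
by rewrite !mulrA.
Qed.

(** The line descends the strip one rhombus at a time. The last triangle has no partner, so
    [cross_up] alone applies there and leaves the line crossing the bottom edge. *)
Lemma slash_cross (l : seq label) s x0 v0 y t : size v0 = (size l).+1 ->
  \sum_s1 \sum_x LA s x0 x s1 * cross_before t y s1 x l v0 = cross_after t y s x0 l v0.
Proof.
elim: l s x0 v0 => [|z l IH] s x0 [|z0 v0] //= [sv].
  case: v0 sv => // _; rewrite /cross_before /cross_after.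
  under eq_bigr => s1 _ do under eq_bigr => x _ do rewrite big_wordsS mulr_sumr.
  transitivity (\sum_s1 \sum_x \sum_z LA s x0 x s1 * LB s1 z0 z t * (piece x z y)%:R).
    apply: eq_bigr => s1 _; apply: eq_bigr => x _; apply: eq_bigr => a _.
    rewrite big_words0 word_op1 slash_cons mulrA natr_sum; congr (_ * _).
    under eq_bigr => c _ do rewrite dash0 natrM.
    by rewrite big_pick.
  rewrite cross_up [RHS](bigD1 s) //= [X in _ = _ + X]big1 ?addr0; last first.
    move=> r rs; rewrite big1 // => y0 _; rewrite big_words0 /= eq_sym (negPf rs) /=.
    by rewrite mulr0 mul0r.
  apply: eq_bigr => y0 _; rewrite big_words0 /= eqxx mulr1; congr (_ * _).
  rewrite natr_sum; under eq_bigr => c _ do rewrite natrM.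
  by rewrite big_pick.
rewrite cross_after_cons.
under eq_bigr => s1 _ do under eq_bigr => x _ do rewrite cross_before_cons.
transitivity (\sum_s2 \sum_w (\sum_s1 \sum_x LA s x0 x s1 *
     (\sum_c \sum_zz LB s1 z0 zz s2 * (piece x zz c)%:R * (piece w z c)%:R)) *
       cross_before t y s2 w l v0).
  under [RHS]eq_bigr => s2 _ do
    (under eq_bigr => w _ do (rewrite mulr_suml;
      under eq_bigr => s1 _ do rewrite mulr_suml);
     rewrite exchange_big /=; under eq_bigr => s1 _ do rewrite exchange_big /=).
  rewrite [RHS]exchange_big; apply: eq_bigr => s1 _ /=.
  rewrite [RHS]exchange_big; apply: eq_bigr => x _ /=.
  rewrite mulr_sumr; apply: eq_bigr => s2 _.
  by rewrite mulr_sumr; apply: eq_bigr => w _; rewrite mulrA.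
under [RHS]eq_bigr => s3 _ do under eq_bigr => w0 _ do rewrite -(IH _ _ _ sv).
under [LHS]eq_bigr => s2 _ do under eq_bigr => w _ do rewrite cross_commute.
transitivity (\sum_s3 \sum_w0 \sum_s2
  \sum_w (\sum_c0 \sum_zz (piece x0 z0 c0)%:R * (piece w0 zz c0)%:R * LB s zz z s3)
      * (LA s3 w0 w s2 * cross_before t y s2 w l v0)); last first.
  apply: eq_bigr => s3 _; apply: eq_bigr => w0 _.
  by rewrite mulr_sumr; apply: eq_bigr => s2 _; rewrite mulr_sumr.
  under [RHS]eq_bigr => s3 _ do
    (rewrite exchange_big /=; under eq_bigr => s2 _ do rewrite exchange_big /=).
  rewrite [RHS]exchange_big; apply: eq_bigr => s2 _ /=.
  rewrite [RHS]exchange_big; apply: eq_bigr => w _ /=.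
  rewrite mulr_suml; apply: eq_bigr => s3 _; rewrite mulr_suml.
  by apply: eq_bigr => w0 _; rewrite mulrA.
Qed.
End Train.

(** * Puzzles as chains of strips, and the line crossing a whole triangle *)

Definition strip (k : bool) (x : label) (u v : seq label) (k' : bool) (y : label) : nat :=
  if k then slash k' y x u v else dash k' y x u v.

(* Sequences of strips leading from the word u0 to the word v; the top edges T and
   the bottom edges B (true for /, false for -) are listed from right to left. *)
Fixpoint chains (u0 : seq label) (T B : seq (bool * label)) (v : seq label) : nat :=
  match T, B with
  | [::], [::] => v == u0
  | (k, x) :: T', (k', y) :: B' =>
      \sum_(u <- words label (size v + k' - k))
         strip k x u v k' y * chains u0 T' B' u
  | _, _ => 0
  end%N.

Definition sides (k : bool) (w : seq label) : seq (bool * label) := [seq (k, x) | x <- w].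

Definition triangle (la nu v : seq label) : nat :=
  chains [::] (sides true la) (sides false nu) v.

Section Word.
Variables (R : comNzRingType) (u : R).
Lemma word_op_rcons (S : finType) (A : eqType) (L : S -> A -> A -> S -> R) s v a w b t :
  size v = size w ->
  word_op L s (rcons v a) (rcons w b) t = \sum_r word_op L s v w r * L r a b t.
Proof.
elim: v w s => [|c v IH] [|d w] s //= => [_|[sz]].
  rewrite big_pick (bigD1 s) //= eqxx mul1r big1 ?addr0 // => r.
  by rewrite eq_sym => /negPf ->; rewrite mul0r.
under eq_bigr => r _ do rewrite IH // mulr_sumr.
rewrite exchange_big; apply: eq_bigr => r' _ /=.
by rewrite mulr_suml; apply: eq_bigr => r _; rewrite mulrA.
Qed.

Definition addstrip_step (c a b c' : bool) : R :=
  match c, a, b, c' with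
  | false, false, false, false => u
  | false, true, true, false => u
  | false, false, true, true => 1
  | true, true, false, false => u
  | true, true, true, true => 1
  | _, _, _, _ => 0
  end.

(* For words of length n this is u ^ (n - number of added boxes), or 0 when the
   second word does not arise from the first by adding a vertical strip. *)
Definition addstrip (c : bool) (w w' : seq bool) : R := word_op addstrip_step c w w' false.

Lemma sum_word_op_consl (S A : finType) (L : S -> A -> A -> S -> R) n s a w t
    (G : seq A -> R) :
  \sum_(v <- words A n.+1) word_op L s (a :: w) v t * G v
  = \sum_b \sum_r L s a b r * \sum_(v <- words A n) word_op L r w v t * G (b :: v).
Proof.
rewrite big_wordsS; apply: eq_bigr => b _.
under eq_bigr => v _ do rewrite /= mulr_suml.
rewrite exchange_big; apply: eq_bigr => r _ /=.
by rewrite mulr_sumr; apply: eq_bigr => v _; rewrite mulrA.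
Qed.

Lemma sum_word_op_consr (S A : finType) (L : S -> A -> A -> S -> R) n s a w t
    (G : seq A -> R) :
  \sum_(v <- words A n.+1) G v * word_op L s v (a :: w) t
  = \sum_b \sum_r L s b a r * \sum_(v <- words A n) G (b :: v) * word_op L r v w t.
Proof.
rewrite big_wordsS; apply: eq_bigr => b _.
under eq_bigr => v _ do rewrite /= mulr_sumr.
rewrite exchange_big; apply: eq_bigr => r _ /=.
by rewrite mulr_sumr; apply: eq_bigr => v _; rewrite mulrCA.
Qed.

Lemma crossR_bool (n : nat) (c : bool) (w : seq bool) (G : seq label -> R) :
  size w = n ->
  \sum_(v <- words label n) word_op (crossR u) (Some c) (map Some w) v (Some false) * G v
  = \sum_(w' <- words bool n) addstrip c w w' * G (map Some w').
Proof.
(* Writing the label 10 over a 0 or a 1 puts the line in state 10, from which a word of 0s and 1s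
   never leads back to state 0. Hence only the labels 0 and 1 survive. *)
have none w1 v : word_op (crossR u) None (map Some w1) v (Some false) = 0.
  elim: w1 v => [|a w1 IH] [|b v] //=.
  by rewrite big_label !IH; case: a; case: b => [[]|] /=; rewrite ?mul0r ?mulr0 ?addr0.
elim: w n c G => [|a w IH] n c G <-.
  by rewrite !big_words0.
rewrite [map _ _]/= !sum_word_op_consl.
have N H : \sum_(v <- words label (size w))
   word_op (crossR u) None [seq Some i | i <- w] v (Some false) * H v = 0.
  by rewrite big1 // => v _; rewrite none mul0r.
rewrite !(big_label, big_bool) !N !(IH _ _ _ erefl).
by case: c; case: a; rewrite /= ?(mul0r, mulr0, add0r, addr0).
Qed.

(** Along the bottom the carry of [addstrip] is the state 10, not the state 1 as along the right
    side. Here a label 10 leads to state 1, which cannot return to state 0 while 0s and 1s are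
    written. *)
Lemma crossD_bool (n : nat) (c : bool) (w : seq bool) (G : seq label -> R) :
  size w = n ->
  \sum_(v <- words label n) G v *
     word_op (crossD u) (if c then None else Some false) v (map Some w) (Some false)
  = \sum_(w' <- words bool n) G (map Some w') * addstrip c w' w.
Proof.
have some w1 v : word_op (crossD u) (Some true) v (map Some w1) (Some false) = 0.
  elim: w1 v => [|a w1 IH] [|b v] //=.
  rewrite big_label !IH; case: a; case: b => [[]|] /=; rewrite ?mul0r ?mulr0 ?addr0 //.
elim: w n c G => [|a w IH] n c G <-.
  by rewrite !big_words0; case: c.
rewrite [map _ _]/= !sum_word_op_consr.
have N H : \sum_(v <- words label (size w))
   H v * word_op (crossD u) (Some true) v [seq Some i | i <- w] (Some false) = 0.
  by rewrite big1 // => v _; rewrite some mulr0.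
rewrite !(big_label, big_bool) !N.
rewrite !(IH _ true _ erefl) !(IH _ false _ erefl).
by case: c; case: a; rewrite /= ?(mul0r, mulr0, add0r, addr0).
Qed.


(** The line runs along the bottom from left to right, whereas [chains] lists the bottom edges from
    right to left; the state is therefore passed from the tail to the head. *)
Fixpoint crossD_rev (w w' : seq label) (t : label) : R :=
  match w, w' with
  | [::], [::] => (Some false == t)%:R
  | a :: v, b :: v' => \sum_r crossD_rev v v' r * crossD u r a b t
  | _, _ => 0
  end.

Lemma crossD_revE w w' t : size w = size w' -> crossD_rev w w' t
  = word_op (crossD u) (Some false) (rev w) (rev w') t.
Proof.
elim: w w' t => [|a w IH] [|b w'] t //= [sz].
rewrite !rev_cons word_op_rcons ?size_rev //; apply: eq_bigr => r _.
by rewrite IH.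
Qed.

Arguments crossL : simpl never.

(** Induction over the strips from right to left: [slash_cross] takes the line over one strip and
    one bottom edge, and the left word of that strip becomes the right side of a smaller
    triangle. *)
Lemma triangle_cross (la : seq bool) (nu v0 : seq label) t :
  size v0 = size la -> size nu = size la ->
  \sum_(v <- words label (size la)) word_op (crossR u) (Some false) v0 v t *
    (triangle (map Some la) nu v)%:R
  = \sum_(nu0 <- words label (size la)) (triangle (map Some la) nu0 v0)%:R * crossD_rev
    nu0 nu t.
Proof.
elim: la nu v0 t => [|a la IH] nu v0 t.
  by case: v0 => //; case: nu => // _ _; rewrite !big_words0 /triangle /= mulr1 mul1r.
case: nu => // y nu; rewrite [size (a :: la)]/=; move=> sv [snu].
have crL s x : crossL u (Some false) (Some a) x s = (x == Some a)%:R * (s == Some false)%:R.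
  by case: x => [[]|]; case: s => [[]|]; case: (a); rewrite /crossL /=;
    rewrite ?(mulr0, mul0r, mulr1).
have snk w : size w = (size la).+1 -> (size w + false - true)%N = size la.
  by move=> ->; rewrite addn0 subn1.
transitivity (\sum_(l <- words label (size la))
   (\sum_s1 \sum_x crossL u (Some false) (Some a) x s1 * cross_before u t y s1 x l v0)
    * (triangle (map Some la) nu l)%:R).
  transitivity (\sum_(l <- words label (size la)) cross_before u t y (Some false) (Some a)
    l v0 * (triangle (map Some la) nu l)%:R).
    rewrite /cross_before sv; under [RHS]eq_bigr => l _ do rewrite mulr_suml.
    rewrite [RHS]exchange_big /=; apply: eq_big_seq => v; rewrite mem_words => /eqP szv.
    rewrite /triangle /= snk // natr_sum mulr_sumr; apply: eq_bigr => l _.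
    by rewrite natrM mulrA.
  apply: eq_bigr => l _; congr (_ * _); symmetry.
  rewrite (bigD1 (Some false)) //= [X in _ + X]big1 ?addr0; last first.
    by move=> r /negPf nr; rewrite big1 // => x _; rewrite crL nr mulr0 mul0r.
  rewrite (bigD1 (Some a)) //= big1 ?addr0; last first.
    by move=> r /negPf nr; rewrite crL nr mul0r mul0r.
  by rewrite crL !eqxx !mul1r.
symmetry; transitivity (\sum_y0 \sum_(nu0 <- words label (size la))
  (triangle (map Some (a :: la)) (y0 :: nu0) v0)%:R * crossD_rev (y0 :: nu0) (y :: nu) t).
  exact: big_wordsS.
symmetry.
transitivity (\sum_(l <- words label (size la)) cross_after u t y (Some false) (Some a) l
  v0 * (triangle (map Some la) nu l)%:R).
  apply: eq_big_seq => l; rewrite mem_words => /eqP sl.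
  by rewrite slash_cross // sv sl.
transitivity (\sum_s2 \sum_y0 \sum_(l0 <- words label (size la))
  (slash false y0 (Some a) l0 v0)%:R * crossD u s2 y0 y t *
   \sum_(l <- words label (size la)) word_op (crossR u) (Some false) l0 l s2 *
     (triangle (map Some la) nu l)%:R).
  transitivity (\sum_(l <- words label (size la)) \sum_s2 \sum_y0
    \sum_(l0 <- words label (size la))
    (slash false y0 (Some a) l0 v0)%:R * crossD u s2 y0 y t *
      (word_op (crossR u) (Some false) l0 l s2 * (triangle (map Some la) nu l)%:R)).
    apply: eq_big_seq => l; rewrite mem_words => /eqP sl.
    rewrite /cross_after sl mulr_suml; apply: eq_bigr => s2 _.
    rewrite mulr_suml; apply: eq_bigr => y0 _.
    rewrite mulr_suml; apply: eq_bigr => l0 _; ring.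
  rewrite exchange_big; apply: eq_bigr => s2 _ /=.
  rewrite exchange_big; apply: eq_bigr => y0 _ /=.
  rewrite exchange_big; apply: eq_bigr => l0 _ /=.
  by rewrite mulr_sumr.
rewrite exchange_big; apply: eq_bigr => y0 _ /=.
transitivity (\sum_s2 \sum_(l0 <- words label (size la)) \sum_(nu0 <- words label (size la))
  (slash false y0 (Some a) l0 v0)%:R * (triangle (map Some la) nu0 l0)%:R *
    (crossD_rev nu0 nu s2 * crossD u s2 y0 y t)).
  apply: eq_bigr => s2 _; apply: eq_big_seq => l0; rewrite mem_words => /eqP sl0.
  rewrite IH // mulr_sumr; apply: eq_bigr => nu0 _; ring.
under [LHS]eq_bigr => s2 _ do rewrite exchange_big /=.
rewrite exchange_big /=; apply: eq_bigr => nu0 _.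
rewrite mulr_sumr; apply: eq_bigr => s2 _.
rewrite /triangle /= snk // natr_sum mulr_suml; apply: eq_bigr => l0 _.
by rewrite natrM.
Qed.

(** The left side is read upwards and the bottom from left to right, opposite to the order of the
    strips in [chains]; hence the two reversals. *)
Definition puzzles (la mu nu : seq bool) : nat :=
  triangle (map Some (rev la)) (map Some (rev nu)) (map Some mu).

Lemma puzzles_addstrip (la mu nu : seq bool) :
  size mu = size la -> size nu = size la ->
  \sum_(mu' <- words bool (size la)) addstrip false mu mu' * (puzzles la mu' nu)%:R
  = \sum_(nu' <- words bool (size la)) (puzzles la mu nu')%:R * addstrip false nu' nu.
Proof.
move=> smu snu.
rewrite
  -(crossR_bool false (fun v => (triangle (map Some (rev la)) (map Some (rev nu)) v)%:R))
  //.
have := @triangle_cross (rev la) (map Some (rev nu)) (map Some mu) (Some false).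
rewrite !size_map !size_rev => -> //.
pose G v := (triangle (map Some (rev la)) (rev v) (map Some mu))%:R : R.
transitivity (\sum_(nu' <- words bool (size la)) G (map Some nu') * addstrip false nu'
  nu); last first.
  by apply: eq_bigr => v _; rewrite /G /puzzles -map_rev.
rewrite -(crossD_bool false) // -[LHS]big_words_rev.
apply: eq_big_seq => v; rewrite mem_words => /eqP sv.
rewrite crossD_revE; last by rewrite size_rev size_map size_rev sv.
by rewrite revK -[rev (map _ _)]map_rev revK.
Qed.
End Word.

Local Close Scope ring_scope.

(** * Forced corners and the rotation of the hexagon *)

Lemma sum_label (F : label -> nat) : \sum_x F x = F None + (F (Some true) + F (Some false)).
Proof. exact: big_label. Qed.

Lemma strip_slash x z u v k' y :
  strip true x u (z :: v) k' y = \sum_c piece x z c * strip false c u v k' y.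
Proof. by []. Qed.

Lemma strip_dash x z u v k' y :
  strip false x (z :: u) v k' y = \sum_w piece w z x * strip true w u v k' y.
Proof. by []. Qed.

Lemma strip_slash0 x u k' y : strip true x u [::] k' y = [&& u == [::], k' & x == y].
Proof. by []. Qed.

Lemma strip_dash0 x v k' y : strip false x [::] v k' y = [&& v == [::], ~~ k' & x == y].
Proof. by []. Qed.

Arguments strip : simpl never.

(** Together with [strip_rcons_left] this peels a strip from its lower end, the mirror image of the
    defining recursion; the rotation [strip_rev] follows. The induction is on the total length
    because the recursion consumes the two words in turn. *)
Lemma strip_rcons_right k x u v z y :
  strip k x u (rcons v z) false y = \sum_w strip k x u v true w * piece w z y.
Proof.
have [n] := ubnP (size u + size v); elim: n => // n IH in k x u v *.
rewrite ltnS => le; case: k.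
  case: v le => [|z0 v] le.
    rewrite [rcons _ _]/= strip_slash sum_label [RHS]sum_label.
    case: u le => [|z1 u] le.
      by rewrite !strip_slash0 !strip_dash0; clear IH; case: x => [[]|]; case: z => [[]|];
        case: y => [[]|].
    have Z c : strip false c (z1 :: u) [::] false y = 0.
      by rewrite strip_dash big1 // => w _; rewrite strip_slash0 andbF muln0.
    by rewrite !Z !strip_slash0 !muln0.
  rewrite rcons_cons strip_slash.
  have le' : size u + size v < n by move: le => /=; lia.
  under eq_bigr => c _ do rewrite IH // big_distrr /=.
  rewrite exchange_big; apply: eq_bigr => w _ /=; rewrite strip_slash big_distrl.
  by apply: eq_bigr => c _; rewrite /= mulnA.
case: u le => [|z1 u] le.
  rewrite strip_dash0 big1 => [|w _]; last by rewrite strip_dash0 !andbF.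
  by case: (v).
rewrite strip_dash; have le' : size u + size v < n by move: le => /=; lia.
under eq_bigr => c _ do rewrite IH // big_distrr /=.
rewrite exchange_big; apply: eq_bigr => w _ /=; rewrite strip_dash big_distrl.
by apply: eq_bigr => c _; rewrite /= mulnA.
Qed.

Lemma strip_rcons_left k x u v z w :
  strip k x (rcons u z) v true w = \sum_c strip k x u v false c * piece w z c.
Proof.
have [n] := ubnP (size u + size v); elim: n => // n IH in k x u v *.
rewrite ltnS => le; case: k.
  case: v le => [|z0 v] le.
    rewrite strip_slash0 big1 => [|c _]; last by rewrite strip_slash0 !andbF.
    by case: (u).
  rewrite strip_slash.
  have le' : size u + size v < n by move: le => /=; lia.
  under eq_bigr => c _ do rewrite IH // big_distrr /=.
  rewrite exchange_big; apply: eq_bigr => c _ /=; rewrite strip_slash big_distrl.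
  by apply: eq_bigr => c' _; rewrite /= mulnA.
case: u le => [|z1 u] le.
  rewrite [rcons _ _]/= strip_dash sum_label [RHS]sum_label.
  case: v le => [|z1 v] le.
    by rewrite !strip_slash0 !strip_dash0; clear IH; case: x => [[]|]; case: z => [[]|];
      case: w => [[]|].
  have Z c : strip true c [::] (z1 :: v) true w = 0.
    by rewrite strip_slash big1 // => d _; rewrite strip_dash0 andbF muln0.
  by rewrite !Z !strip_dash0 !muln0.
rewrite rcons_cons strip_dash; have le' : size u + size v < n by move: le => /=; lia.
under eq_bigr => c _ do rewrite IH // big_distrr /=.
rewrite exchange_big; apply: eq_bigr => c _ /=; rewrite strip_dash big_distrl.
by apply: eq_bigr => c' _; rewrite /= mulnA.
Qed.

Lemma strip_rev k x u v k' y :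
  strip k x u v k' y = strip k' y (rev v) (rev u) k x.
Proof.
have [n] := ubnP (size u + size v); elim: n => // n IH in k x k' y u v *.
rewrite ltnS => le; case: k'.
  case/lastP: u le => [|u z] le.
    rewrite strip_slash0; case: k; last by rewrite strip_dash0 !andbF.
    case: v le => [|z v] le; first by rewrite strip_slash0 (eq_sym x).
    rewrite strip_slash sum_label !strip_dash0 !andbF !muln0.
    by rewrite -size_eq0 size_rev.
  rewrite strip_rcons_left rev_rcons strip_slash; apply: eq_bigr => c _.
  by rewrite mulnC IH //; move: le; rewrite size_rcons; lia.
case/lastP: v le => [|v z] le.
  rewrite strip_dash0; case: k; first by rewrite strip_slash0 !andbF.
  case: u le => [|z u] le; first by rewrite strip_dash0 (eq_sym x).
  rewrite strip_dash sum_label !strip_slash0 !andbF !muln0.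
  by rewrite -size_eq0 size_rev.
rewrite strip_rcons_right rev_rcons strip_dash; apply: eq_bigr => c _.
by rewrite mulnC IH //; move: le; rewrite size_rcons; lia.
Qed.

Lemma strip_size k x u v k' y :
  strip k x u v k' y != 0 -> size u + k = size v + k'.
Proof.
have [n] := ubnP (size u + size v); elim: n => // n IH in k x u v *.
rewrite ltnS => le; case: k.
  case: v le => [|z v] le.
    by rewrite strip_slash0 eqb0 negbK => /and3P[/eqP -> -> _].
  rewrite strip_slash sum_nat_eq0 negb_forall => /existsP[c] /=.
  rewrite muln_eq0 negb_or => /andP[_ /IH]; move: le => /=; lia.
case: u le => [|z u] le.
  by rewrite strip_dash0 eqb0 negbK => /and3P[/eqP -> /negPf -> _].
rewrite strip_dash sum_nat_eq0 negb_forall => /existsP[c] /=.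
rewrite muln_eq0 negb_or => /andP[_ /IH]; move: le => /=; lia.
Qed.

Lemma chains_cons u0 k x T k' y B v :
  chains u0 ((k, x) :: T) ((k', y) :: B) v
  = \sum_(u <- words label (size v + k' - k)) strip k x u v k' y * chains u0 T B u.
Proof. by []. Qed.

Lemma sum_words_pick n (F : seq label -> nat) u1 :
  (F u1 != 0 -> size u1 = n) ->
  \sum_(u <- words label n) F u * (u == u1) = F u1.
Proof.
move=> H; case: (eqVneq (size u1) n) => [s1|n1].
  rewrite (@big_words1 _ _ _ _ _ _ _ s1) ?eqxx ?muln1 // => w _ /negPf ->.
  by rewrite muln0.
rewrite big_seq big1; first by apply/eqP; rewrite eq_sym; apply: contraNT n1 => /H ->.
move=> u; rewrite mem_words => /eqP su; case: eqP => [E|]; rewrite ?muln0 //.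
by case/eqP: n1; rewrite -E.
Qed.

Lemma chains_rcons u0 T B k x k' y v : size T = size B ->
  chains u0 (rcons T (k, x)) (rcons B (k', y)) v
  = \sum_(u <- words label (size u0 + k - k')) strip k x u0 u k' y * chains u T B v.
Proof.
elim: T B v => [|[k1 x1] T IH] [|[k2 y2] B] //= v.
  move=> _; rewrite (@sum_words_pick _ (fun u => strip k x u v k' y));
    last by move/strip_size; lia.
  under eq_bigr => u _ do rewrite eq_sym.
  by rewrite (@sum_words_pick _ (fun u => strip k x u0 u k' y)) //; move/strip_size; lia.
move=> [sz]; under eq_bigr => u _ do rewrite IH // big_distrr /=.
rewrite exchange_big; apply: eq_bigr => u _ /=; rewrite big_distrr /=.
by apply: eq_bigr => u' _; rewrite mulnCA.
Qed.

Lemma chains_rev u0 T B v : size T = size B ->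
  chains u0 T B v = chains (rev v) (rev B) (rev T) (rev u0).
Proof.
elim: T B v => [|[k x] T IH] [|[k' y] B] // v.
  by rewrite /= (inj_eq (can_inj revK)) eq_sym.
move=> [sz]; rewrite !rev_cons chains_rcons ?size_rev // chains_cons.
rewrite -[RHS]big_words_rev; apply: eq_bigr => u _.
by rewrite strip_rev IH.
Qed.

Lemma chains_cat u0 u1 T1 T2 B1 B2 v : size T1 = size B1 ->
  (forall u, chains u0 T2 B2 u = (u == u1)) ->
  chains u0 (T1 ++ T2) (B1 ++ B2) v = chains u1 T1 B1 v.
Proof.
move=> sz H; elim: T1 B1 v sz => [|[k x] T IH] [|[k' y] B] //= v.
by case=> sz; apply: eq_bigr => u _; rewrite IH.
Qed.

(** * Corners with a sorted side *)

Notation letters := (map (@Some bool)).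

Lemma strip_slash_cons x z u b v k' y :
  strip true x u (z :: b :: v) k' y =
  if u is z1 :: u1
  then \sum_c \sum_w piece x z c * piece w z1 c * strip true w u1 (b :: v) k' y else 0.
Proof.
case: u => [|z1 u1]; rewrite strip_slash.
  by rewrite big1 // => c _; rewrite strip_dash0 muln0.
apply: eq_bigr => c _; rewrite strip_dash big_distrr /=.
by apply: eq_bigr => w _; rewrite mulnA.
Qed.

Lemma strip_dash_cons x z u b v k' y :
  strip false x (z :: b :: u) v k' y =
  if v is z1 :: v1
  then \sum_w \sum_c piece w z x * piece w z1 c * strip false c (b :: u) v1 k' y else 0.
Proof.
case: v => [|z1 v1]; rewrite strip_dash.
  by rewrite big1 // => c _; rewrite strip_slash0 muln0.
apply: eq_bigr => c _; rewrite strip_slash big_distrr /=.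
by apply: eq_bigr => w _; rewrite mulnA.
Qed.

Lemma slash_bad x z u v k' y : (forall c, piece x z c = false) -> strip true x u (z :: v)
  k' y = 0.
Proof. by move=> H; rewrite strip_slash big1 // => c _; rewrite H. Qed.

Lemma dash_bad x z u v k' y : (forall w, piece w z x = false) -> strip false x (z :: u) v
  k' y = 0.
Proof. by move=> H; rewrite strip_dash big1 // => c _; rewrite H. Qed.

Ltac by_labels := by do ?[case=> [[]|] //].

Lemma top_ones k' y q u v :
  strip true (Some true) u (nseq q.+1 (Some true) ++ v) k' y
  = (take q u == nseq q (Some true)) * strip false (Some true) (drop q u) v k' y.
Proof.
elim: q u => [|q IH] u.
  rewrite take0 drop0 mul1n [_ ++ v]/= strip_slash sum_label /=.
  by rewrite !mul0n mul1n addn0.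
rewrite [nseq _ _ ++ _]/= strip_slash_cons; case: u => [|z u]; first by rewrite mul0n.
rewrite !sum_label /= !mul0n !add0n ?addn0 !mul1n.
have B w : strip true (Some false) u (Some true :: w) k' y = 0 by apply: slash_bad;
  by_labels.
rewrite -[_ :: _ ++ _]/(nseq q.+1 (Some true) ++ v) IH eqseq_cons.
by case: z => [[]|]; rewrite /= ?mul0n ?mul1n ?addn0 ?add0n ?B.
Qed.

Lemma top_zeros k' y q u v :
  strip false (Some false) u (nseq q (Some true) ++ v) k' y
  = (take q u == nseq q (Some true)) * strip false (Some false) (drop q u) v k' y.
Proof.
elim: q u => [|q IH] u; first by rewrite take0 drop0 mul1n.
case: u => [|z u]; first by rewrite strip_dash0 mul0n.
rewrite [nseq _ _ ++ _]/= strip_dash sum_label [take _ _]/= eqseq_cons /=.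
have B w : strip true (Some false) u (Some true :: w) k' y = 0 by apply: slash_bad;
  by_labels.
have E w : strip true None u (Some true :: w) k' y = strip false (Some false) u w k' y.
  by rewrite strip_slash sum_label /= !mul0n mul1n !add0n.
by case: z => [[]|]; rewrite /= ?mul0n ?mul1n ?addn0 ?add0n ?B ?E ?IH.
Qed.

(** The part of the strip beside the sorted word is forced triangle by triangle; it ends in a
    horizontal edge with the label a of its first edge, and the left word again begins with a sorted
    word, shorter by one letter. Iteration cuts off the whole corner. *)
Lemma top_corner (a : bool) g u v k' y :
  strip true (Some a) u (letters (sort01 (a :: g)) ++ v) k' y
  = (take (size g) u == letters (sort01 g)) * strip false (Some a) (drop (size g) u) v k' y.
Proof.
have sg : size g = count_mem false g + count_mem true g.
  by rewrite -(count_predC (pred1 false)); congr addn; apply: eq_count => -[].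
rewrite /sort01 !map_cat !map_nseq -!catA sg /=.
move: (count_mem false g) (count_mem true g) => p q {g sg}.
case: a; rewrite ?add0n ?add1n.
  elim: p u => [|p IH] u; first exact: top_ones.
  have [b [w E]] : exists b w, nseq p (Some false) ++ nseq q.+1 (Some true) ++ v = b :: w.
    by case: p {IH} => [|p]; do 2 eexists.
  rewrite [nseq p.+1 _ ++ _]/= E strip_slash_cons; case: u => [|z u];
    first by rewrite mul0n.
  rewrite !sum_label /= !mul0n !add0n ?addn0 !mul1n -E IH.
  by case: z => [[]|]; rewrite ?mul0n ?mul1n ?addn0.
elim: p u => [|p IH] u.
  rewrite add0n [nseq 1 _ ++ _]/= strip_slash sum_label /= !mul0n mul1n !add0n.
  exact: top_zeros.
rewrite [nseq p.+2 _ ++ _]/= strip_slash_cons; case: u => [|z u]; first by rewrite mul0n.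
have B w : strip true None u (Some false :: w) k' y = 0 by apply: slash_bad; by_labels.
rewrite !sum_label /= !mul0n !add0n ?addn0 !mul1n B muln0 add0n.
rewrite -[_ :: _ ++ _]/(nseq p.+1 (Some false) ++ nseq q (Some true) ++ v) IH.
by case: z => [[]|]; rewrite ?mul0n ?mul1n ?addn0.
Qed.

Lemma bottom_zeros k' y p u v :
  strip false (Some false) (nseq p.+1 (Some false) ++ v) u k' y
  = (take p u == nseq p (Some false)) * strip true (Some false) v (drop p u) k' y.
Proof.
elim: p u => [|p IH] u.
  rewrite take0 drop0 mul1n [_ ++ v]/= strip_dash sum_label /=.
  by rewrite !mul0n mul1n.
rewrite [nseq _ _ ++ _]/= strip_dash_cons; case: u => [|z u]; first by rewrite mul0n.
rewrite !sum_label /= !mul0n !add0n ?addn0 !mul1n.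
have B w : strip false (Some true) (Some false :: w) u k' y = 0 by apply: dash_bad;
  by_labels.
rewrite -[_ :: _ ++ _]/(nseq p.+1 (Some false) ++ v) IH eqseq_cons.
by case: z => [[]|]; rewrite /= ?mul0n ?mul1n ?addn0 ?add0n ?B.
Qed.

Lemma bottom_ones k' y p u v :
  strip true (Some true) (nseq p (Some false) ++ v) u k' y
  = (take p u == nseq p (Some false)) * strip true (Some true) v (drop p u) k' y.
Proof.
elim: p u => [|p IH] u; first by rewrite take0 drop0 mul1n.
case: u => [|z u]; first by rewrite strip_slash0 mul0n.
rewrite [nseq _ _ ++ _]/= strip_slash sum_label [take _ _]/= eqseq_cons /=.
have B w : strip false (Some true) (Some false :: w) u k' y = 0 by apply: dash_bad;
  by_labels.
have E w : strip false None (Some false :: w) u k' y = strip true (Some true) w u k' y.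
  by rewrite strip_dash sum_label /= !mul0n mul1n addn0.
by case: z => [[]|]; rewrite /= ?mul0n ?mul1n ?addn0 ?add0n ?B ?E ?IH.
Qed.

Lemma bottom_corner (a : bool) g u v k' y :
  strip false (Some a) (rev (letters (sort01 (a :: g))) ++ v) u k' y
  = (take (size g) u == rev (letters (sort01 g))) * strip true (Some a) v
    (drop (size g) u) k' y.
Proof.
have sg : size g = count_mem true g + count_mem false g.
  by rewrite -(count_predC (pred1 true)); congr addn; apply: eq_count => -[].
rewrite /sort01 !map_cat !rev_cat !map_nseq !rev_nseq -!catA sg /=.
move: (count_mem false g) (count_mem true g) => p q {g sg}.
case: a; rewrite ?add0n ?add1n.
  elim: q u => [|q IH] u.
    rewrite [nseq 1 _ ++ _]/= strip_dash sum_label /= !mul0n mul1n !add0n.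
    by rewrite addn0; exact: bottom_ones.
  rewrite [nseq q.+2 _ ++ _]/= strip_dash_cons; case: u => [|z u]; first by rewrite mul0n.
  have B w : strip false None (Some true :: w) u k' y = 0 by apply: dash_bad; by_labels.
  rewrite !sum_label /= !mul0n !add0n ?addn0 !mul1n B muln0 ?add0n ?addn0.
  rewrite -[_ :: _ ++ _]/(nseq q.+1 (Some true) ++ nseq p (Some false) ++ v) IH.
  by case: z => [[]|]; rewrite ?mul0n ?mul1n ?addn0.
elim: q u => [|q IH] u; first exact: bottom_zeros.
have [b [w E]] : exists b w, nseq q (Some true) ++ nseq p.+1 (Some false) ++ v = b :: w.
  by case: q {IH} => [|q]; do 2 eexists.
rewrite [nseq q.+1 _ ++ _]/= E strip_dash_cons; case: u => [|z u]; first by rewrite mul0n.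
rewrite !sum_label /= !mul0n !add0n ?addn0 !mul1n -E IH.
by case: z => [[]|]; rewrite ?mul0n ?mul1n ?addn0.
Qed.

Lemma size_sort01 g : size (sort01 g) = size g.
Proof.
rewrite size_cat !size_nseq -(count_predC (pred1 false)); congr addn.
by apply: eq_count => -[].
Qed.

Lemma sort01_rev g : sort01 (rev g) = sort01 g.
Proof. by rewrite /sort01 !count_rev. Qed.

Lemma sum_words_prefix n m (s : seq label) (F G : seq label -> nat) : size s = n ->
  \sum_(u <- words label (n + m)) (take n u == s) * F (drop n u) * G u
  = \sum_(u <- words label m) F u * G (s ++ u).
Proof.
move=> sn; rewrite big_words_cat (@big_words1 _ _ _ _ _ _ _ sn) => [|w sw ws].
  by apply: eq_bigr => u _; rewrite take_size_cat // drop_size_cat // eqxx mul1n.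
by apply: big1 => u _; rewrite take_size_cat // (negPf ws) !mul0n.
Qed.

(** A triangle with left side g and right side sort(g) has exactly one filling, and its bottom side
    is again g, so it can be cut off. *)
Lemma chains_top u0 g T B v :
  chains u0 (sides true (letters g) ++ T) B (letters (sort01 g) ++ v)
  = chains u0 (sides false (letters g) ++ T) B v.
Proof.
elim: g B v => [|a g IH] [|[k' y] B] v //=.
rewrite -!/(letters _) size_cat size_map size_sort01.
have -> : (size (a :: g) + size v + k' - 1 = size g + (size v + k'))%N by rewrite /=; lia.
under eq_bigr => u _ do rewrite top_corner.
rewrite (@sum_words_prefix _ _ _ (fun u => strip false (Some a) u v k' y));
  last by rewrite size_map size_sort01.
by rewrite subn0; apply: eq_bigr => u _; rewrite IH.
Qed.

Lemma chains_bottom u0 g T B v :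
  chains u0 T (sides false (letters g) ++ B) (v ++ letters (sort01 g))
  = chains u0 T (sides true (letters g) ++ B) v.
Proof.
elim: g T v => [|a g IH] [|[k x] T] v; rewrite ?cats0 //=.
rewrite -!/(letters _) size_cat size_map size_sort01.
have -> : (size v + size (a :: g) + 0 - k = size g + (size v + 1 - k))%N by case: k;
  rewrite /=; lia.
rewrite -[LHS]big_words_rev -[RHS]big_words_rev.
under eq_bigr => u _ do rewrite strip_rev rev_cat revK bottom_corner.
rewrite (@sum_words_prefix _ _ _ (fun u => strip true (Some a) (rev v) u k x)
  (fun u => chains _ _ _ (rev u))); last first.
  by rewrite size_rev size_map size_sort01.
by apply: eq_bigr => u _; rewrite rev_cat revK IH [in RHS]strip_rev revK.
Qed.

(* The word on the right of the first strips of the lower left corner: its sorted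
   left side has only absorbed the first j ones of the bottom word Y so far, the
   other ones still appear as 10. *)
Fixpoint defer (j : nat) (Y : seq bool) : seq label :=
  match Y, j with
  | [::], _ => [::]
  | false :: Y', _ => Some false :: defer j Y'
  | true :: Y', 0 => None :: defer 0 Y'
  | true :: Y', j'.+1 => Some true :: defer j' Y'
  end.

Lemma defer_all Y : defer (count_mem true Y) Y = letters Y.
Proof. by elim: Y => // -[] Y IH /=; rewrite ?add0n IH. Qed.

Lemma slash_defer0 Y y v :
  strip true (Some false) (defer 0 Y) v false (Some y) = (v == defer 0 (rcons Y y)).
Proof.
elim: Y v => [|b Y IH] [|z v].
- by rewrite strip_slash0; case: y.
- rewrite strip_slash sum_label !strip_dash0.
  by case: y; case: z => [[]|];
    rewrite /= ?mul0n ?addn0 ?eqseq_cons ?andbF ?andbT ?mul1n //; case: v.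
- by rewrite strip_slash0 andbF; case: b.
rewrite strip_slash sum_label; case: b; rewrite /= !strip_dash !sum_label /=;
  by case: z => [[]|]; rewrite /= ?(mul0n, addn0, mul1n, add0n) ?eqseq_cons ?IH.
Qed.

Lemma slash_defer j Y y v : j <= count_mem true Y -> (j == count_mem true Y) ==> y ->
  strip true (Some true) (defer j Y) v false (Some y) = (v == defer j.+1 (rcons Y y)).
Proof.
elim: Y j v => [|b Y IH] j [|z v].
- by rewrite strip_slash0; case: y; case: j.
- case: j => // _ /= ->; rewrite strip_slash sum_label !strip_dash0.
  by case: z => [[]|]; rewrite /= ?mul0n ?addn0 ?eqseq_cons ?andbF ?andbT ?mul1n //;
    case: v.
- by rewrite strip_slash0 andbF; case: b; case: j.
rewrite strip_slash sum_label; case: b => /=.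
  case: j => [|j]; rewrite ?add1n ?ltnS ?eqSS => H1 H2; rewrite !strip_dash !sum_label /=;
    by case: z => [[]|];
      rewrite /= ?(mul0n, addn0, mul1n, add0n) ?eqseq_cons ?IH ?slash_defer0.
rewrite add0n => H1 H2; rewrite !strip_dash !sum_label /=.
by case: z => [[]|]; rewrite /= ?(mul0n, addn0, mul1n, add0n) ?eqseq_cons ?IH.
Qed.

(** The statement is general in j so that it can be proved strip by strip; the bound on the 0s says
    that Y has at least j ones. With j equal to the number of ones, no 10 is left and the corner
    returns Y itself. *)
Lemma chains_left j p Y v : size Y = j + p -> count_mem false Y <= p ->
  chains [::] (sides true (nseq j (Some true) ++ nseq p (Some false)))
    (sides false (letters (rev Y))) v
  = (v == defer j Y).
Proof.
have cY (X : seq bool) : size X = count_mem false X + count_mem true X.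
  by rewrite -(count_predC (pred1 false)); congr addn; apply: eq_count => -[].
elim: j Y v => [|j IH] Y v.
  rewrite add0n [nseq 0 _ ++ _]/=; move=> sY _; rewrite -{p}sY.
  elim/last_ind: Y v => [|Y y IH] v //.
  rewrite size_rcons rev_rcons /= -!/(letters _).
  under eq_bigr => u _ do rewrite IH.
  rewrite (@sum_words_pick _ (fun u => strip true _ u v false _));
    first exact: slash_defer0.
  by move/strip_size; lia.
case/lastP: Y => [|Y y] //; rewrite size_rcons addSn => -[sY].
rewrite -cats1 count_cat /= => le.
have le' : count_mem false Y <= p := leq_trans (leq_addr _ _) le.
have := cY Y; rewrite cats1 rev_rcons /= -!/(letters _) => E.
under eq_bigr => u _ do rewrite IH //.
rewrite (@sum_words_pick _ (fun u => strip true _ u v false _)); last by move/strip_size;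
  lia.
have jc : j <= count_mem true Y by rewrite -(leq_add2r p) -sY E addnC leq_add2l.
rewrite slash_defer //; apply/implyP => /eqP jE; case: y le => //=.
move: E; rewrite sY -jE addnC => /addIn ->; rewrite addn0 addn1 ltnn //.
Qed.

(** * The hexagon *)

Definition hexagon (al be ga de ep ze : seq bool) : nat :=
  chains (letters (rev al)) (sides false (letters (rev ga)) ++ sides true
    (letters (rev be)))
    (sides true (letters ep) ++ sides false (letters ze)) (letters de).

Lemma hexagon_rev al be ga de ep ze : size ga + size be = size ep + size ze ->
  hexagon al be ga de ep ze = hexagon de ep ze al be ga.
Proof.
move=> sz; rewrite /hexagon chains_rev ?size_cat ?size_map ?size_rev //.
by rewrite !rev_cat /sides -!map_rev !revK.
Qed.

Lemma puzzles_hexagon al be ga de ep ze : size ga + size be = size ep + size ze ->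
  puzzles (sort01 al ++ be ++ ga) (sort01 ga ++ de ++ sort01 ep) (rev (ep ++ ze ++ al))
  = hexagon al be ga de ep ze.
Proof.
move=> sz; rewrite /puzzles /triangle /hexagon revK.
have -> : sides true (letters (rev (sort01 al ++ be ++ ga)))
  = (sides true (letters (rev ga)) ++ sides true (letters (rev be)))
    ++ sides true (nseq (count_mem true al) (Some true) ++ nseq (count_mem false al)
      (Some false)).
  by rewrite /sort01 !rev_cat !rev_nseq /sides !map_cat !map_nseq.
have -> : sides false (letters (ep ++ ze ++ al))
  = (sides false (letters ep) ++ sides false (letters ze)) ++ sides false
    (letters (rev (rev al))).
  by rewrite revK /sides !map_cat catA.
rewrite (@chains_cat _ (letters (rev al))); first last.
- move=> u; rewrite chains_left ?count_rev // -?(count_rev _ al) ?defer_all //.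
  rewrite -(count_predC (pred1 true)); congr addn; apply: eq_count => -[] //.
- by rewrite !size_cat !size_map !size_rev.
by rewrite (map_cat _ (sort01 ga)) (map_cat _ de) -(sort01_rev ga) chains_top chains_bottom.
Qed.

(** The whole puzzle is one top corner. A sorted string is the empty partition, so this is the base
    case of the puzzle rule. *)
Lemma puzzles_sorted la nu : puzzles la (sort01 la) nu = (la == nu).
Proof.
rewrite /puzzles /triangle -(sort01_rev la) -[letters (sort01 _)]cats0 -[sides true _]cats0.
rewrite chains_top cats0 -(inj_eq (can_inj revK) la).
move: (rev la) (rev nu) => A B; elim: A B => [|a A IH] [|b B] //=.
rewrite big_words0 -!/(letters _) strip_dash0 IH eqseq_cons mulnb //.
Qed.

Local Open Scope ring_scope.

(** * Tableaux *)

Fixpoint interlacing (p : seq nat) : seq (seq nat) :=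
  match p with
  | a :: (b :: _) as p' =>
      [seq c :: q | c <- iota b (a.+1 - b), q <- interlacing p']
  | _ => [:: [::]]
  end.

Lemma mem_interlacing p q : p != [::] -> sorted geq p ->
  (q \in interlacing p)
  = (size p == (size q).+1)
    && all (fun i => nth 0 p i.+1 <= nth 0 q i <= nth 0 p i)%N (iota 0 (size q)).
Proof.
elim: p q => // a [|b p] IH q _ /=; first by case: q.
move=> /andP[ba sp].
apply/allpairsP/andP => [[[c q'] /= [Hc Hq ->]]|[]].
  move: Hq; rewrite IH // => /andP[/eqP sz /allP H]; split; first by move: sz => /= ->.
  rewrite /=; apply/andP; split; first by move: Hc; rewrite mem_iota; lia.
  apply/allP => i; rewrite -add1n iotaDl => /mapP[j Hj ->] /=; exact: H.
case: q => // c q /=; rewrite eqSS => sz /andP[Hc /allP H].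
exists (c, q); split => //=; first by rewrite mem_iota; lia.
rewrite IH //= sz; apply/allP => i Hi.
move: Hi; rewrite mem_iota => Hi; have := H i.+1; rewrite mem_iota; apply; lia.
Qed.

Lemma interlacing_uniq p : uniq (interlacing p).
Proof.
elim: p => // a [|b p] IH //=.
by apply: allpairs_uniq => //; [exact: iota_uniq|move=> [? ?] [? ?] _ _ /= [-> ->]].
Qed.

Lemma interlacing_cons a b p : interlacing (a :: b :: p) =
  [seq c :: q | c <- iota b (a.+1 - b), q <- interlacing (b :: p)].
Proof. by []. Qed.

Arguments interlacing : simpl never.

Section Box.
Variable sh : seq nat.

Lemma boxP i j : (j < nth 0 sh i)%N -> exists b : box sh, row_of b = i /\ col_of b = j.
Proof.
move=> ji; have si : (i < size sh)%N.
  by rewrite ltnNge; apply/negP => le; rewrite nth_default in ji.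
by exists (Tagged (fun i : 'I_(size sh) => 'I_(nth 0%N sh i))
  (Ordinal ji : 'I_(nth 0%N sh (Ordinal si)))).
Qed.

Lemma col_lt (b : box sh) : (col_of b < nth 0 sh (row_of b))%N.
Proof. exact: ltn_ord. Qed.

Lemma box_inj (b b' : box sh) : row_of b = row_of b' -> col_of b = col_of b' -> b = b'.
Proof.
case: b b' => [i j] [i' j'] /val_inj /= E; move: E j j' => -> j j' E.
by congr existT; apply: val_inj.
Qed.

Variables (K : nat) (m : 'I_K).

(** The default m matters: in the branching rule it is the largest entry allowed, so a tableau read
    on a larger shape automatically has m in every new box. *)
Definition entry (T : {ffun box sh -> 'I_K}) (i j : nat) : 'I_K :=
  if [pick b : box sh | (row_of b == i) && (col_of b == j)] is Some b then T b else m.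

Lemma entry_box T (b : box sh) : entry T (row_of b) (col_of b) = T b.
Proof.
rewrite /entry; case: pickP => [b' /andP[/eqP r /eqP c]|/(_ b)].
  by rewrite (box_inj r c).
by rewrite !eqxx.
Qed.

Lemma entry_out T i j : (nth 0 sh i <= j)%N -> entry T i j = m.
Proof.
move=> le; rewrite /entry; case: pickP => // b /andP[/eqP r /eqP c].
by have := col_lt b; rewrite r c ltnNge le.
Qed.

Definition filling (F : nat -> nat -> 'I_K) : {ffun box sh -> 'I_K} :=
  [ffun b => F (row_of b) (col_of b)].

Lemma entry_filling F i j : (j < nth 0 sh i)%N -> entry (filling F) i j = F i j.
Proof. by move=> /boxP[b [<- <-]]; rewrite entry_box ffunE. Qed.

Lemma eq_filling F G : (forall i j, (j < nth 0 sh i)%N -> F i j = G i j) -> filling F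
  = filling G.
Proof. by move=> E; apply/ffunP => b; rewrite !ffunE E ?col_lt. Qed.

Lemma filling_entry T : filling (entry T) = T.
Proof. by apply/ffunP => b; rewrite ffunE entry_box. Qed.

Lemma semistandardP T :
  reflect (forall i j, (j < nth 0 sh i)%N ->
    (forall j', (j <= j' < nth 0 sh i)%N -> (entry T i j <= entry T i j')%N)
    /\ (forall i', (i < i')%N -> (j < nth 0 sh i')%N -> (entry T i j < entry T i' j)%N))
   (semistandard T).
Proof.
apply: (iffP forallP) => [H i j /boxP[b [<- <-]]|H b].
  split=> [j' /andP[le /boxP[b' [r c]]]|i' lt /boxP[b' [r c]]].
    have /forallP/(_ b')/andP[/implyP H1 _] := H b.
    by rewrite -c -{2}r !entry_box; apply: H1; rewrite r eqxx c.
  have /forallP/(_ b')/andP[_ /implyP H1] := H b.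
  by rewrite -{2}c -r !entry_box; apply: H1; rewrite r c eqxx lt.
apply/forallP => b'; have [H1 H2] := H _ _ (col_lt b).
rewrite -!(entry_box T); apply/andP; split; apply/implyP => /andP[].
  by move=> /eqP r le; rewrite -r; apply: H1; rewrite le r col_lt.
by move=> lt /eqP c; rewrite -c; apply: H2; rewrite // c col_lt.
Qed.

Lemma prod_box (R : comNzRingType) (x : 'I_K -> R) (T : {ffun box sh -> 'I_K}) :
  \prod_(b : box sh) x (T b)
  = \prod_(i < size sh) \prod_(j < nth 0 sh i) x (entry T i j).
Proof.
rewrite (@sig_big_dep _ _ _ _ (fun i : 'I_(size sh) => 'I_(nth 0%N sh i)) xpredT
  (fun _ => xpredT) (fun i j => x (entry T i j))) /=.
apply: eq_bigr => b _; congr x.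
by rewrite -[LHS](entry_box T).
Qed.
End Box.

Lemma find_iota (a : pred nat) n k : (k <= n)%N ->
  (forall j, (j < k)%N -> ~~ a j) -> ((k < n)%N -> a k) -> find a (iota 0 n) = k.
Proof.
move=> kn lo hi; have szk : size (iota 0 k) = k by rewrite size_iota.
rewrite -(subnKC kn) iotaD find_cat szk add0n.
have -> : has a (iota 0 k) = false.
  by apply/hasP => -[j]; rewrite mem_iota => /andP[_ /lo /negP].
case: (n - k)%N (subn_gt0 k n) => [|d] /=; first by rewrite addn0.
by move/esym/hi ->; rewrite addn0.
Qed.

Lemma sumn_nth p n : size p = n -> sumn p = (\sum_(i < n) nth 0 p i)%N.
Proof. by move=> <-; rewrite sumnE (big_nth 0) big_mkord. Qed.

Lemma sorted_nth p i j : sorted geq p -> (i <= j)%N -> (nth 0 p j <= nth 0 p i)%N.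
Proof.
move=> sp ij; case: (ltnP j (size p)) => [jp|/(nth_default 0) -> //].
exact: (sorted_leq_nth (rev_trans leq_trans) leqnn 0%N sp _ _ (leq_ltn_trans ij jp) jp ij).
Qed.

(** * The branching rule: removing the largest entry of a tableau *)

Section Branching.
Variables (K : nat) (R : comNzRingType) (x : 'I_K -> R).

(** The bound m varies while the type of entries stays fixed, so the number of variables can be
    lowered by induction without changing types. *)
Definition bounded sh (T : {ffun box sh -> 'I_K}) (m : nat) :=
  semistandard T && [forall b, (T b < m)%N].

Definition tableaux_sum (m : nat) (sh : seq nat) : R :=
  \sum_(T : {ffun box sh -> 'I_K} | bounded T m) \prod_b x (T b).

Lemma boundedP sh (T : {ffun box sh -> 'I_K}) (m0 : 'I_K) m :
  reflect (semistandard T /\ forall i j, (j < nth 0 sh i)%N -> (entry m0 T i j < m)%N)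
    (bounded T m).
Proof.
apply: (iffP andP) => -[ss H]; split => //.
  by move=> i j /boxP[b [<- <-]]; rewrite entry_box; exact: (forallP H).
by apply/forallP => b; rewrite -(entry_box m0 T) H ?col_lt.
Qed.

Variable m : 'I_K.
Variable sh : seq nat.
Hypothesis size_sh : size sh = m.+1.
Hypothesis sorted_sh : sorted geq sh.

(** The shape of the subtableau of entries below m. It has only m rows: by [semistandard_ge] the row
    of index m contains no entry below m. *)
Definition trunc (T : {ffun box sh -> 'I_K}) : seq nat :=
  mkseq (fun i => find (fun j => ~~ (entry m T i j < m)%N) (iota 0 (nth 0 sh i))) m.

Lemma semistandard_ge (T : {ffun box sh -> 'I_K}) i j : semistandard T ->
  (j < nth 0 sh i)%N -> (i <= entry m T i j)%N.
Proof.
move=> /(semistandardP m) ss; elim: i => // i IH lt.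
have lt' : (j < nth 0 sh i)%N by apply: leq_trans lt _; apply: sorted_nth.
have [_ /(_ i.+1 (leqnn _) lt)] := ss _ _ lt'.
by apply: leq_ltn_trans; exact: IH.
Qed.

Lemma truncP T i j : bounded T m.+1 -> (j < nth 0 sh i)%N ->
  (entry m T i j < m)%N = (j < nth 0 (trunc T) i)%N.
Proof.
move=> /(boundedP _ m)[ss bd] lt; case: (ltnP i m) => im; last first.
  rewrite [nth _ (trunc T) _]nth_default ?size_mkseq // ltn0 ltnNge.
  by rewrite (leq_trans im) // semistandard_ge.
rewrite nth_mkseq //; set s := iota _ _; set a := fun _ => _.
case: (ltnP j (find a s)) => [/(before_find 0%N)|le].
  by rewrite nth_iota // add0n => /negbFE.
have fs : has a s by rewrite has_find size_iota (leq_ltn_trans le).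
have := nth_find 0%N fs; rewrite nth_iota; last first.
  by move: fs; rewrite has_find size_iota.
rewrite add0n => /negP nf.
apply/negP => lt2; apply: nf; apply: leq_ltn_trans lt2.
have lt3 := leq_ltn_trans le lt.
by have [/(_ j) + _] := semistandardP m _ ss _ _ lt3; apply; rewrite le.
Qed.

Lemma trunc_interlacing T : bounded T m.+1 -> trunc T \in interlacing sh.
Proof.
move=> bT; rewrite mem_interlacing //; last by rewrite -size_eq0 size_sh.
rewrite size_mkseq size_sh eqxx /=; apply/allP => i; rewrite mem_iota add0n => /andP[_ im].
apply/andP; split; last by rewrite nth_mkseq // -{2}[nth 0 sh i](size_iota 0) find_size.
rewrite leqNgt; apply/negP => lt.
have lt2 : (nth 0 (trunc T) i < nth 0 sh i)%N.
  by apply: leq_trans lt _; apply: sorted_nth.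
have := truncP bT lt2; rewrite ltnn.
have [ss bd] := boundedP _ m _ bT.
have [_ /(_ i.+1 (leqnn _) lt) lt3] := semistandardP m _ ss _ _ lt2.
by rewrite (leq_trans lt3) // -ltnS bd.
Qed.

Section Fixed.
Variable p : seq nat.
Hypothesis p_int : p \in interlacing sh.

Lemma size_interlacing : size p = m.
Proof.
by move: p_int; rewrite mem_interlacing -?size_eq0 ?size_sh // => /andP[/eqP[]].
Qed.

Lemma interlacing_bounds i : (nth 0 sh i.+1 <= nth 0 p i <= nth 0 sh i)%N.
Proof.
case: (ltnP i m) => im;
  last by rewrite [nth _ p _]nth_default ?size_interlacing // nth_default ?size_sh.
move: p_int; rewrite mem_interlacing -?size_eq0 ?size_sh // => /andP[_ /allP]; apply.
by rewrite mem_iota size_interlacing.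
Qed.

Let le_p i : (nth 0 p i <= nth 0 sh i)%N. Proof. by case/andP: (interlacing_bounds i). Qed.

Definition extend (T : {ffun box p -> 'I_K}) : {ffun box sh -> 'I_K} := filling sh
  (entry m T).
Definition restrict (T : {ffun box sh -> 'I_K}) : {ffun box p -> 'I_K} := filling p
  (entry m T).

Lemma entry_extend T i j : entry m (extend T) i j = entry m T i j.
Proof.
case: (ltnP j (nth 0 sh i)) => H; first by rewrite entry_filling.
by rewrite !entry_out // (leq_trans _ H).
Qed.

Lemma restrictK T : bounded T m.+1 -> trunc T = p -> extend (restrict T) = T.
Proof.
move=> bT tT; rewrite -[RHS](filling_entry m); apply: eq_filling => i j lt.
have [ss bd] := boundedP _ m _ bT.
have := truncP bT lt; rewrite tT; case: (ltnP j (nth 0 p i)) => [lt2 _|le /negbT];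
  first by rewrite entry_filling.
rewrite -leqNgt => ge; rewrite [LHS]entry_out //; apply/val_inj/eqP.
by rewrite eqn_leq ge /= -ltnS bd.
Qed.

Lemma extendK T : restrict (extend T) = T.
Proof.
rewrite -[RHS](filling_entry m); apply: eq_filling => i j lt.
exact: entry_extend.
Qed.

Lemma bounded_extend T :
  bounded (extend T) m.+1 && (trunc (extend T) == p) = bounded T m.
Proof.
apply/andP/idP => [[bT /eqP tT]|].
  have [ss bd] := boundedP _ m _ bT.
  apply/(boundedP _ m); split; last first.
    move=> i j lt; rewrite -entry_extend (truncP bT) ?tT //; exact: leq_trans lt _.
  apply/(semistandardP m) => i j lt.
  have [H1 H2] := semistandardP m _ ss i j (leq_trans lt (le_p i)).
  split => [j' /andP[le lt']|i' le lt'].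
    by rewrite -!entry_extend H1 // le (leq_trans lt').
  by rewrite -!entry_extend H2 // (leq_trans lt').
move=> /(boundedP _ m)[ss bd].
have em i j : (entry m T i j <= m)%N.
  by case: (ltnP j (nth 0 p i)) => [/bd/ltnW //|/(entry_out m T) ->].
split.
  apply/(boundedP _ m); split; last by move=> i j _; rewrite entry_extend ltnS.
  apply/(semistandardP m) => i j lt; split => [j' /andP[le lt']|i' le lt'].
    rewrite !entry_extend; case: (ltnP j' (nth 0 p i)) => H.
      have [H1 _] := semistandardP m _ ss i j (leq_ltn_trans le H).
      by apply: H1; rewrite le.
    by rewrite (entry_out m T H).
  (* Interlacing means that the added boxes form a horizontal strip: a box of [sh] with another one
     below it already lies in p, so two new entries m never share a column. *)
  have jp : (j < nth 0 p i)%N.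
    case/andP: (interlacing_bounds i) => H _; apply: leq_trans H; apply: leq_trans lt' _.
    exact: sorted_nth.
  rewrite !entry_extend; case: (ltnP j (nth 0 p i')) => H.
    by have [_ H2] := semistandardP m _ ss i j jp; apply: H2.
  by rewrite (entry_out m T H) bd.
apply/eqP/(@eq_from_nth _ 0%N); rewrite size_mkseq ?size_interlacing // => i im.
rewrite nth_mkseq //; apply: find_iota => // [j lt|lt].
  by rewrite entry_extend bd.
by rewrite entry_extend entry_out // ltnn.
Qed.

Lemma prod_extend T :
  \prod_b x (extend T b) = x m ^+ (sumn sh - sumn p) * \prod_b x (T b).
Proof.
rewrite !(prod_box m) size_sh size_interlacing.
transitivity (\prod_(i < m.+1) ((\prod_(j < nth 0 p i) x (entry m T i j)) * x m ^+
  (nth 0 sh i - nth 0 p i))).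
  apply: eq_bigr => i _.
  under eq_bigr => j _ do rewrite entry_extend.
  rewrite -(big_mkord xpredT (fun j => x (entry m T i j)))
    (big_cat_nat (leq0n _) (le_p i)) //= big_mkord.
  congr (_ * _); rewrite big_nat_cond.
  rewrite (eq_bigr (fun=> x m)); last by move=> j /andP[/andP[H _] _]; rewrite entry_out.
  by rewrite -big_nat_cond prodr_const_nat.
rewrite big_split /= mulrC; congr (_ * _); last first.
  rewrite big_ord_recr /= [X in _ * X](_ : _ = 1) ?mulr1 //.
  by rewrite -(big_mkord xpredT (fun j => x (entry m T m j))) [nth _ p _]nth_default
    ?size_interlacing // big_geq.
rewrite prodrXr; congr (_ ^+ _).
rewrite sumnB // (sumn_nth size_sh); congr (_ - _)%N.
by rewrite big_ord_recr /= [nth _ p m]nth_default ?size_interlacing // addn0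
  (sumn_nth size_interlacing).
Qed.

End Fixed.

Theorem tableaux_sum_branch :
  tableaux_sum m.+1 sh
  = \sum_(p <- interlacing sh) x m ^+ (sumn sh - sumn p) * tableaux_sum m p.
Proof.
transitivity (\sum_(p <- interlacing sh)
   \sum_(T : {ffun box sh -> 'I_K} | bounded T m.+1 && (trunc T == p)) \prod_b x (T b)).
  rewrite (exchange_big_dep (fun T : {ffun box sh -> 'I_K} => bounded T m.+1)) /=;
    last by move=> p T _ /andP[].
  apply: eq_bigr => T bT; rewrite (eq_bigl (pred1 (trunc T))); last first.
    by move=> p; rewrite bT eq_sym.
  rewrite -[RHS]big_filter (_ : [seq _ <- interlacing sh | _] = [:: trunc T]) ?big_seq1 //.
  by apply: filter_pred1_uniq; [exact: interlacing_uniq|exact: trunc_interlacing].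
apply: eq_big_seq => p pint; rewrite /tableaux_sum mulr_sumr.
rewrite (reindex_onto (@extend p) (@restrict p)) /=; last first.
  by move=> T /andP[bT /eqP tT]; apply: restrictK.
apply: eq_big => T; first by rewrite extendK // eqxx andbT bounded_extend.
by rewrite prod_extend.
Qed.
End Branching.

(** * The branching rule on strings *)

Lemma path_shape w : path geq (count_mem false w) (shape_of w).
Proof.
elim: w => // -[] w IH; rewrite /= ?add0n ?add1n ?leqnn //.
by case: (shape_of w) IH => //= a s /andP[/leqW -> ->].
Qed.

Lemma size_shape w : size (shape_of w) = count_mem true w.
Proof. by elim: w => // -[] w IH /=; rewrite IH. Qed.

Lemma sorted_shape w : sorted geq (shape_of w).
Proof. exact: path_sorted (path_shape w). Qed.

Lemma sumn_interlacing p q : sorted geq p -> q \in interlacing p -> (sumn q <= sumn p)%N.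
Proof.
elim: p q => [|a [|b p] IH] q sp; rewrite ?inE.
- by move=> /eqP ->.
- by move=> /eqP ->.
case/allpairsP => -[c q'] /= [Hc Hq ->] /=.
move: sp => /= /andP[ba sp]; have := IH _ sp Hq; move: Hc; rewrite mem_iota /=; lia.
Qed.

Section Shift.
Variables (R : comNzRingType).

(* Strings as partitions: going from left to right, state true means that a 1 has
   been read that still has to be put down further right, each step costing x. *)
Definition remove1_step (x : R) (h a b h' : bool) : R :=
  match h, a, b, h' with
  | false, false, false, false => 1
  | false, true, false, true => 1
  | true, false, false, true => x
  | true, false, true, false => 1
  | true, true, true, true => 1
  | _, _, _, _ => 0
  end.

(** Ending in state true lets the last 1 fall off the right end: for h = false the new string has
    one part fewer, as required when one variable is removed. *)
Definition remove1 (x : R) h w w' : R := word_op (remove1_step x) h w w' true.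

Lemma remove1_count x h w w' :
  remove1 x h w w' != 0 -> (count_mem true w').+1 = (count_mem true w + h)%N /\ size w'
    = size w.
Proof.
rewrite /remove1; elim: w h w' => [|a w IH] h [|b w'] //=; rewrite ?eqxx //.
  by case: h; rewrite ?eqxx.
rewrite big_bool; case: h; case: a; case: b => /=;
  rewrite ?(mul0r, addr0, add0r, mul1r, eqxx) // => H.
- have [E ->] := IH _ _ H; split => //; move: E => /=; lia.
- have [E ->] := IH _ _ H; split => //; move: E => /=; lia.
- have /IH[E ->] : word_op (remove1_step x) true w w' true != 0.
    by apply: contraNneq H => ->; rewrite mulr0.
  by split => //; move: E => /=; lia.
- have [E ->] := IH _ _ H; split => //; move: E => /=; lia.
- have [E ->] := IH _ _ H; split => //; move: E => /=; lia.
Qed.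

Lemma remove1_zeros x h w w' : remove1 x h w w' != 0 ->
  count_mem false w' + h = (count_mem false w).+1.
Proof.
move=> /remove1_count[]; have E v : size v = (count_mem true v + count_mem false v)%N.
  by rewrite -(count_predC (pred1 true)); congr addn; apply: eq_count => -[].
rewrite !E; case: h; lia.
Qed.

(** A pending 1 stands in front of all remaining 0s and thus acts as an extra first part equal to
    their number; this is the partition p in the case h = true. *)
Lemma sum_remove1 x (h : bool) w (F : seq nat -> R) : h || (0 < count_mem true w)%N ->
  let p := if h then count_mem false w :: shape_of w else shape_of w in
  \sum_(w' <- words bool (size w)) remove1 x h w w' * F (shape_of w')
  = \sum_(q <- interlacing p) x ^+ (sumn p - sumn q) * F q.
Proof.
have sub_le w1 q : q \in interlacing (count_mem false w1 :: shape_of w1) ->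
  (sumn q <= count_mem false w1 + sumn (shape_of w1))%N.
  by move/(sumn_interlacing (path_shape w1 : sorted geq (_ :: _))).
have none w1 (G : seq bool -> R) : count_mem true w1 = 0%N ->
   \sum_(w' <- words bool (size w1)) remove1 x false w1 w' * G w' = 0.
  move=> c0; apply: big1 => w' _;
    have [->|/remove1_count[]] := eqVneq (remove1 x false w1 w') 0.
    by rewrite mul0r.
  by rewrite c0.
have cons w1 (h1 : bool) (G : seq nat -> R) :
   \sum_(w' <- words bool (size w1)) remove1 x h1 w1 w' * G (shape_of (true :: w'))
   = \sum_(w' <- words bool (size w1)) remove1 x h1 w1 w' * G ((count_mem false w1
     + ~~ h1)%N :: shape_of w').
  apply: eq_bigr => w' _.
  have [->|/remove1_zeros E] := eqVneq (remove1 x h1 w1 w') 0; first by rewrite !mul0r.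
  congr (_ * G (_ :: _)); case: h1 E => /=; lia.
elim: w h F => [|a w IH] h F.
  by case: h => // _ /=; rewrite big_words0 /interlacing big_seq1 /remove1 /= subn0 mul1r.
rewrite [size _]/= /remove1 sum_word_op_consl !big_bool.
set S1 := fun b h1 => \sum_(v <- words bool (size w)) word_op (remove1_step x) h1 w v true
  * F (shape_of (b :: v)).
rewrite -[X in remove1_step _ _ _ true true * X]/(S1 true true)
  -[X in remove1_step _ _ _ true false * X]/(S1 true false).
rewrite -[X in remove1_step _ _ _ false true * X]/(S1 false true)
  -[X in remove1_step _ _ _ false false * X]/(S1 false false).
case: h; case: a; rewrite /= ?(mul0r, add0r, addr0, mul1r) => H.
- rewrite add0n interlacing_cons subSnn big_allpairs_dep big_seq1.
  rewrite /S1 cons addn0 (IH true (fun q => F (_ :: q))) //=.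
  apply: eq_big_seq => q /sub_le le; congr (x ^+ _ * _); lia.
- have IH1 := IH true F isT; rewrite /S1 {}IH1 /=.
  have := path_shape w; case Ew: (shape_of w) => [|b s] /=.
    move=> _; rewrite /interlacing !big_seq1 /= !addn0 !subn0 cons none ?add0r;
      last by rewrite -size_shape Ew.
    by rewrite mulrA -exprS add1n.
  move=> /andP[bz0 _]; have {bz0} bz : (b <= count_mem false w)%N := bz0.
    rewrite !interlacing_cons add1n (_ : ((count_mem false w).+2 - b)%N
    = ((count_mem false w).+1 - b + 1)%N); last by lia.
  (* The largest value of the first part of q corresponds to putting the pending 1 down at this 0;
     the smaller values carry it past the 0 at the cost x. *)
  rewrite iotaD allpairs_cat big_cat /= addrC; congr (_ + _).
    rewrite mulr_sumr; apply: eq_big_seq => q Hq.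
    have := sub_le w q; rewrite Ew interlacing_cons => /(_ Hq) /= le.
    by rewrite mulrA -exprS; congr (x ^+ _ * _); lia.
  rewrite cons (IH false (fun q => F (_ :: q))) /=; last by rewrite -size_shape Ew.
  rewrite Ew cats0 big_map.

  have -> : (b + ((count_mem false w).+1 - b) = count_mem false w + 1)%N by lia.
  apply: eq_bigr => q _; congr (x ^+ _ * _); rewrite /=; lia.
- by rewrite /S1 (IH true F isT).
- by rewrite /S1 (IH false F).
Qed.
End Shift.

Section Commute.
Variables (R : comNzRingType) (u x : R).

Definition add_remove (h c : bool) (w w' : seq bool) : R :=
  \sum_(v <- words bool (size w)) addstrip u c w v * remove1 x h v w'.
Definition remove_add (h c : bool) (w w' : seq bool) : R :=
  \sum_(v <- words bool (size w)) remove1 x h w v * addstrip u c v w'.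

Lemma add_remove_cons h c a w b w' :
  add_remove h c (a :: w) (b :: w')
  = \sum_d \sum_c' \sum_h' addstrip_step u c a d c' * remove1_step x h d b h' * add_remove
    h' c' w w'.
Proof.
rewrite /add_remove [size _]/= big_wordsS; apply: eq_bigr => d _.
transitivity (\sum_(v <- words bool (size w)) \sum_c' \sum_h'
   addstrip_step u c a d c' * remove1_step x h d b h' * (addstrip u c' w v * remove1 x h'
     v w')).
  apply: eq_bigr => v _; rewrite /addstrip /remove1 !word_op_cons mulr_suml;
    apply: eq_bigr => c' _.
  by rewrite mulr_sumr; apply: eq_bigr => h' _; ring.
rewrite exchange_big; apply: eq_bigr => c' _ /=.
rewrite exchange_big; apply: eq_bigr => h' _ /=.
by rewrite mulr_sumr.
Qed.

Lemma remove_add_cons h c a w b w' :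
  remove_add h c (a :: w) (b :: w')
  = \sum_d \sum_c' \sum_h' remove1_step x h a d h' * addstrip_step u c d b c' * remove_add
    h' c' w w'.
Proof.
rewrite /remove_add [size _]/= big_wordsS; apply: eq_bigr => d _.
transitivity (\sum_(v <- words bool (size w)) \sum_c' \sum_h'
   remove1_step x h a d h' * addstrip_step u c d b c' * (remove1 x h' w v * addstrip u c'
     v w')).
  apply: eq_bigr => v _; rewrite /addstrip /remove1 !word_op_cons mulr_sumr;
    apply: eq_bigr => c' _.
  by rewrite mulr_suml; apply: eq_bigr => h' _; ring.
rewrite exchange_big; apply: eq_bigr => c' _ /=.
rewrite exchange_big; apply: eq_bigr => h' _ /=.
by rewrite mulr_sumr.
Qed.

(* Only the first equation is needed, for words beginning with 0, where the last
   term vanishes; the others make the induction go through. *)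
Lemma add_remove_commute w w' : size w = size w' ->
  [/\ (u + x) * remove_add false false w w' = u * add_remove false false w w'
    + add_remove true true w w',
      remove_add true true w w' = remove_add false false w w',
      remove_add false true w w' = 0 &
      add_remove true false w w' = remove_add true false w w'].
Proof.
elim: w w' => [|a w IH] [|b w'] //=.
  move=> _; rewrite /add_remove /remove_add /= !big_words0 /remove1 /addstrip /=.
  by split; ring.
case=> sw; have [E1 E2 E3 E4] := IH _ sw.
rewrite !add_remove_cons !remove_add_cons !big_bool /=.
case: a; case: b; rewrite /= E2 E3 E4; split;
  rewrite ?(mul0r, mul1r, mulr1, mulr0, addr0, add0r) // ?mulrDr ?(mulrCA (u + x)) ?E1 //
    -?mulrDl ?E1; ring.
Qed.
End Commute.

(** * Pieri's rule for vertical strips *)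

Section Pieri.
Variables (R : comNzRingType) (u : R) (K : nat) (x : 'I_K -> R).

Lemma tableaux_sum_remove1 (m : 'I_K) w : count_mem true w = m.+1 ->
  tableaux_sum x m.+1 (shape_of w)
  = \sum_(w' <- words bool (size w)) remove1 (x m) false w w' * tableaux_sum x m
    (shape_of w').
Proof.
move=> cw; rewrite tableaux_sum_branch ?size_shape // ?sorted_shape //.
by rewrite (sum_remove1 _ (tableaux_sum x m)) //= cw.
Qed.

Lemma tableaux_sum_empty m sh : (box sh -> False) -> tableaux_sum x m sh = 1.
Proof.
move=> nb.
have sst (T : {ffun box sh -> 'I_K}) : bounded T m.
  apply/andP; split; last by apply/forallP => b; case: (nb b).
  by apply/forallP => b; case: (nb b).
transitivity (\sum_(T : {ffun box sh -> 'I_K}) (1 : R)).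
  by apply: eq_big => [T|T _]; [rewrite sst|apply: big1 => b; case: (nb b)].
rewrite sumr_const card_ffun; have -> : #|{: box sh}| = 0%N; last by rewrite expn0.
by apply: eq_card0 => b; case: (nb b).
Qed.

Lemma tableaux_sum_nil : tableaux_sum x 0 [::] = 1.
Proof. by apply: tableaux_sum_empty; case=> -[]. Qed.

Lemma addstrip_count c w w' : addstrip u c w w' != 0 ->
  (count_mem true w' + c = count_mem true w)%N /\ size w' = size w.
Proof.
rewrite /addstrip; elim: w c w' => [|a w IH] c [|b w'] //=; rewrite ?eqxx //.
  by case: c; rewrite ?eqxx.
rewrite big_bool; case: c; case: a; case: b => /=;
  rewrite ?(mul0r, addr0, add0r, mul1r, eqxx) // => H.
- by have [E ->] := IH _ _ H; split => //; move: E => /=; lia.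
- have /IH[E ->] : word_op (addstrip_step u) false w w' false != 0.
    by apply: contraNneq H => ->; rewrite mulr0.
  by split => //; move: E => /=; lia.
- have /IH[E ->] : word_op (addstrip_step u) false w w' false != 0.
    by apply: contraNneq H => ->; rewrite mulr0.
  by split => //; move: E => /=; lia.
- by have [E ->] := IH _ _ H; split => //; move: E => /=; lia.
- have /IH[E ->] : word_op (addstrip_step u) false w w' false != 0.
    by apply: contraNneq H => ->; rewrite mulr0.
  by split => //; move: E => /=; lia.
Qed.

(** The product is the generating polynomial of the elementary symmetric polynomials. The extra
    leading 0 is enough room, since a vertical strip lengthens each part by at most one. The
    induction removes the last variable on both sides, and the commutation of adding and removing
    supplies its factor. *)
Theorem pieri m w : (m <= K)%N -> count_mem true w = m ->
  u ^+ m * \sum_(w' <- words bool (size w).+1) addstrip u false (false :: w) w' *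
    tableaux_sum x m (shape_of w')
  = u ^+ (size w).+1 * \prod_(i < K | (i < m)%N) (u + x i) * tableaux_sum x m (shape_of w).
Proof.
elim: m w => [|m IH] w mK cw.
  have -> : w = nseq (size w) false.
    by apply/all_pred1P/allP => -[] // /(@count_memPn _ true w)/eqP; rewrite cw.
  rewrite size_nseq expr0 mul1r.
  have -> : \prod_(i < K | (i < 0)%N) (u + x i) = 1 by apply: big_pred0 => i; rewrite ltn0.
  rewrite mulr1.
  rewrite -[false :: _]/(nseq (size w).+1 false).
  rewrite (@big_words1 _ _ _ _ _ _ _ (size_nseq (size w).+1 false)) // => [|w' sw' nw'].
    congr (_ * tableaux_sum x 0 _).
      by rewrite /addstrip; elim: (_.+1) => //= n IHn;
        rewrite big_bool /= mul0r add0r IHn exprS.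
  have [->|/addstrip_count[]] := eqVneq (addstrip u false (nseq (size w).+1 false) w') 0.
    by rewrite mul0r.
  rewrite addn0 count_nseq mul0n => c0; case/negP: nw'; apply/eqP; rewrite -sw'.
  by apply/all_pred1P/allP => -[] // /(@count_memPn _ true w')/eqP; rewrite c0.
pose i : 'I_K := Ordinal mK.
have -> : \prod_(j < K | (j < m.+1)%N) (u + x j)
  = (u + x i) * \prod_(j < K | (j < m)%N) (u + x j).
  rewrite (bigD1 i) //=; congr (_ * _); apply: eq_bigl => j.
  by rewrite -val_eqE /= ltnS ltn_neqAle andbC.
transitivity (u ^+ m * \sum_(r <- words bool (size w).+1) (u * add_remove u (x i) false
  false (false :: w) r) * tableaux_sum x m (shape_of r)).
  rewrite exprSr -mulrA; congr (_ * _); rewrite mulr_sumr.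
  transitivity (\sum_(w' <- words bool (size w).+1) \sum_(r <- words bool (size w).+1)
     u * addstrip u false (false :: w) w' * remove1 (x i) false w' r * tableaux_sum x m
       (shape_of r)).
    apply: eq_big_seq => w'; rewrite mem_words => /eqP sw'.
    have [->|/addstrip_count[]] := eqVneq (addstrip u false (false :: w) w') 0.
      by rewrite mul0r mulr0 big1 // => r _; rewrite !(mulr0, mul0r).
    rewrite addn0 /= add0n cw => cw' _; rewrite (@tableaux_sum_remove1 i) // sw' !mulr_sumr.
    by apply: eq_bigr => r _; rewrite !mulrA.
  rewrite exchange_big; apply: eq_bigr => r _ /=.
  rewrite /add_remove -[size (false :: w)]/(size w).+1 mulr_sumr mulr_suml;
    apply: eq_bigr => w' _; ring.
transitivity (u ^+ m * \sum_(r <- words bool (size w).+1) (u + x i) * remove_add u (x i)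
  false false (false :: w) r * tableaux_sum x m (shape_of r)).
  congr (_ * _); apply: eq_big_seq => r; rewrite mem_words => /eqP sr; congr (_ * _).
  have [-> _ _ _] := @add_remove_commute _ u (x i) (false :: w) r (esym sr).
  rewrite [X in _ + X](_ : _ = 0) ?addr0 //.
  case: r sr => // b r [sr]; rewrite add_remove_cons !big_bool /=.
  by case: b; rewrite !(mul0r, mulr0, addr0).
transitivity ((u + x i) * \sum_(k <- words bool (size w)) remove1 (x i) false w k *
   (u ^+ m * \sum_(r <- words bool (size w).+1) addstrip u false (false :: k) r *
     tableaux_sum x m (shape_of r))).
  transitivity ((u + x i) * (u ^+ m * \sum_(r <- words bool (size w).+1)
    \sum_(k <- words bool (size w)) remove1 (x i) false w k *
    (addstrip u false (false :: k) r * tableaux_sum x m (shape_of r)))).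
    rewrite mulrCA; congr (_ * _); rewrite mulr_sumr; apply: eq_bigr => r _.
    rewrite -mulrA; congr (_ * _).
    rewrite /remove_add [size _]/= big_wordsS big_bool /=.
    rewrite [X in (X + _)](_ : _ = 0) ?add0r; last first.
      by apply: big1 => k _; rewrite /remove1 /= big_bool /= !mul0r addr0 mul0r.
    rewrite mulr_suml; apply: eq_bigr => k _.
    by rewrite /remove1 /= big_bool /= mul0r add0r mul1r mulrA.
  congr (_ * _); rewrite exchange_big mulr_sumr; apply: eq_bigr => k _ /=.
  by rewrite -mulr_sumr mulrCA.
rewrite (@tableaux_sum_remove1 i w cw) -!mulrA [RHS]mulrCA; congr (_ * _).
rewrite !mulr_sumr; apply: eq_big_seq => k; rewrite mem_words => /eqP sk.
have [->|/remove1_count[ck _]] := eqVneq (remove1 (x i) false w k) 0.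
  by rewrite !mul0r !mulr0.
have ck' : count_mem true k = m by move: ck; rewrite cw addn0 => -[].
by have := IH k (ltnW mK) ck'; rewrite sk => ->; ring.
Qed.
End Pieri.

(** * The puzzle rule *)

(** For c = false this selects the vertical strips with [size w - l] boxes, since [addstrip] is a
    monomial or 0. *)
Definition addcoef (l : nat) (c : bool) (w w' : seq bool) : int :=
  (addstrip ('X : {poly int}) c w w')`_l.

Lemma map_addstrip (R : comNzRingType) c w w' :
  map_poly intr (addstrip ('X : {poly int}) c w w') = addstrip ('X : {poly R}) c w w'.
Proof.
rewrite /addstrip; elim: w w' c => [|a w IH] [|b w'] c /=; rewrite ?rmorph0 //.
  by rewrite rmorph_nat.
rewrite rmorph_sum; apply: eq_bigr => c' _; rewrite rmorphM /= IH; congr (_ * _).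
by case: c; case: a; case: b; case: c'; rewrite /= ?rmorph0 ?rmorph1 ?map_polyX.
Qed.

Lemma addcoefE (R : comNzRingType) l c w w' :
  (addstrip ('X : {poly R}) c w w')`_l = (addcoef l c w w')%:~R.
Proof. by rewrite -map_addstrip coef_map. Qed.

Lemma size_addstrip (R : comNzRingType) c w w' :
  (size (addstrip ('X : {poly R}) c w w') <= (size w).+1)%N.
Proof.
rewrite /addstrip; elim: w w' c => [|a w IH] [|b w'] c /=; rewrite ?size_poly0 //.
  by rewrite -polyC_natr size_polyC; case: (_ != 0).
apply: leq_trans (size_sum _ _ _) _; apply/bigmax_leqP => c' _.
have H := IH w' c'.
case: c; case: a; case: b; case: c' H => H;
  rewrite /= ?(mul0r, mul1r, size_poly0) ?(leqW H) //;
  by rewrite mulrC (leq_trans (size_polyMleq _ _)) // size_polyX addn2.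
Qed.

Fixpoint bin_val (w : seq bool) : nat :=
  if w is b :: v then (b * 2 ^ size v + bin_val v)%N else 0%N.

Lemma bin_val_lt w : (bin_val w < 2 ^ size w)%N.
Proof. by elim: w => //= b w IH; rewrite expnS; case: b; lia. Qed.

Lemma bin_val_cat v w : bin_val (v ++ w) = (bin_val v * 2 ^ size w + bin_val w)%N.
Proof. by elim: v => //= b v ->; rewrite size_cat expnD; nia. Qed.


Lemma addcoef_cons l c a w b w' : addcoef l c (a :: w) (b :: w')
  = \sum_r (addstrip_step 'X c a b r * addstrip 'X r w w' : {poly int})`_l.
Proof. by rewrite /addcoef /addstrip word_op_cons coef_sum. Qed.

Lemma addcoefXS l c w w' :
  ('X * addstrip ('X : {poly int}) c w w')`_l.+1 = addcoef l c w w'.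
Proof. by rewrite coefXM. Qed.

Lemma addcoef_big l c w w' : (size w < l)%N -> addcoef l c w w' = 0.
Proof.
by move=> le; apply: nth_default; apply: leq_trans le; exact: size_addstrip.
Qed.

(** When the state equals the letter being read, any next letter may be written and becomes the new
    state, at the cost 'X exactly if it is 0. This shifts w by one place and gives one factor for
    each 0 of w and for the 0 after it; the remaining m ones are copied at the cost 'X each. *)
Lemma addstrip_lead_coef (m : nat) (s : bool) w :
  addcoef (m.+1 + count_mem false w) s (s :: w ++ nseq m true) (w ++ false :: nseq m true)
    = 1.
Proof.
elim: w s => [|b w IH] s.
  have E : addcoef m false (nseq m true) (nseq m true) = 1.
    elim: m => [|m IH]; first by rewrite /addcoef /addstrip /= coefC.
    by rewrite [nseq _ _]/= addcoef_cons big_bool /= mul0r coef0 add0r addcoefXS.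
  by rewrite addn0 [_ ++ _]/= addcoef_cons big_bool; case: s;
    rewrite /= ?mul0r ?coef0 ?add0r addcoefXS.
rewrite [_ ++ nseq m true]/= [_ ++ _ :: _]/= addcoef_cons big_bool.
case: s; case: b;
  rewrite /= ?mul0r ?mul1r ?coef0 ?add0r ?addr0 ?mul1r ?addnS ?addcoefXS ?add0n ?add1n
  -?addnS;
  exact: IH.
Qed.

Lemma addcoef_nil l c a w : addcoef l c (a :: w) [::] = 0.
Proof. by rewrite /addcoef /addstrip /= coef0. Qed.

Lemma addcoef_true_false l w w' : addcoef l true (false :: w) w' = 0.
Proof.
case: w' => [|b w']; first exact: addcoef_nil.
by rewrite addcoef_cons big_bool; case: b; rewrite /= !mul0r !coef0.
Qed.

Lemma addcoef_addstrip l c w w' :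
  addcoef l c w w' != 0 -> addstrip ('X : {poly int}) c w w' != 0.
Proof. by apply: contraNneq; rewrite /addcoef => ->; rewrite coef0. Qed.

Lemma addcoef_ones l n w' : addcoef l false (nseq n true) w' != 0 -> w' = nseq n true.
Proof.
move/addcoef_addstrip/addstrip_count; rewrite addn0 count_nseq mul1n size_nseq => -[c1 sz].
by rewrite -sz; apply/all_pred1P; rewrite all_count sz c1.
Qed.

(* With s = false: of all strings obtained from 0w1^m by adding a vertical strip
   with as many boxes as w has ones, w01^m is the lexicographically largest. *)
Lemma addstrip_lead (m : nat) (s : bool) w w' :
  addcoef (m.+1 + count_mem false w) s (s :: w ++ nseq m true) w' != 0 ->
  w' = w ++ false :: nseq m true \/ (bin_val w' < bin_val (w ++ false :: nseq m true))%N.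
Proof.
elim: w s w' => [|b w IH] s [|b' w']; rewrite ?addcoef_nil ?eqxx //.
  rewrite addn0 [_ ++ _]/= addcoef_cons big_bool; case: b'.
    case: s; rewrite /= ?mul0r ?coef0 ?addr0 mul1r;
      by rewrite -/(addcoef _ _ _ _) addcoef_big ?eqxx // size_nseq.
  by case: s; rewrite /= ?mul0r ?coef0 ?add0r addcoefXS => /addcoef_ones ->; left.
move=> nz; have /addstrip_count[_ sz] := addcoef_addstrip nz.
have {sz} sz : size w' = size (w ++ false :: nseq m true).
  by move: sz; rewrite /= !size_cat /= => -[->]; rewrite addnS.
have red : b' = b -> addcoef (m.+1 + count_mem false w) b (b :: w ++ nseq m true) w' != 0.
  move: nz => + E; rewrite {b'}E [_ ++ nseq m true]/= addcoef_cons big_bool.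
  by case: s; case: b;
    rewrite /= ?mul0r ?mul1r ?coef0 ?add0r ?addr0 ?addnS ?addcoefXS ?add0n ?add1n -?addnS
    ?addcoefXS.
have lt := bin_val_lt w'; rewrite sz in lt.
case: b' red nz => red nz; case: b red nz => red nz; rewrite /= ?mul0n ?mul1n ?add0n.
- case: (IH _ _ (red erefl)) => [->|H]; [by left|right].
  by rewrite sz ltn_add2l.
- move: nz; rewrite [_ ++ nseq m true]/= addcoef_cons big_bool.
  case: s; rewrite /= ?mul0r ?mul1r ?coef0 ?addr0;
    by rewrite -/(addcoef _ _ _ _) addcoef_true_false eqxx.
- by right; apply: leq_trans lt (leq_addr _ _).
- by case: (IH _ _ (red erefl)) => [->|H]; [left|right].
Qed.

Lemma tableaux_sum_rmorph (R S : comNzRingType) (f : {rmorphism R -> S}) K (x : 'I_K -> R)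
  m sh :
  tableaux_sum (fun i => f (x i)) m sh = f (tableaux_sum x m sh).
Proof. by rewrite rmorph_sum /=; apply: eq_bigr => T _; rewrite rmorph_prod. Qed.

(** * Schur polynomials modulo the shapes outside the rectangle *)

Section Module.
Variables (R : comNzRingType) (k : nat) (x : 'I_k -> R).

Definition schur_string (w : seq bool) : R := tableaux_sum x k (shape_of w).

(** The elementary symmetric polynomial of degree N - l, or 0 if there is none. The index l is the
    exponent that [addcoef] uses for strings of length N. *)
Definition ecoef (N l : nat) : R :=
  ('X^N * \prod_(i < k | (i < k)%N) ('X + (x i)%:P))`_(k + l).

Lemma pieri_coef w l : count_mem true w = k ->
  ecoef (size w).+1 l * schur_string w
  = \sum_(w' <- words bool (size w).+1) schur_string w' *~ addcoef l false (false :: w) w'.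
Proof.
move=> cw; have := pieri ('X : {poly R}) (fun i => (x i)%:P) (leqnn k) cw.
move/(congr1 (fun p : {poly R} => p`_(k + l))); rewrite tableaux_sum_rmorph coefMC => <-.
rewrite coefXnM ltnNge leq_addr /= addKn coef_sum; apply: eq_bigr => w' _.
by rewrite tableaux_sum_rmorph coefMC addcoefE mulrC mulrzr.
Qed.

(* The span of the Schur polynomials of partitions that do not fit into n - k
   columns, i.e. of strings of length N >= n with a 1 among the first N - n letters. *)
Definition far (n : nat) (f : R) : Prop :=
  exists2 s : seq (int * seq bool),
    all (fun p => [&& count_mem true p.2 == k, n <= size p.2 & has id
      (take (size p.2 - n) p.2)])%N s
    & f = \sum_(p <- s) schur_string p.2 *~ p.1.

Variable n : nat.

Lemma far0 : far n 0. Proof. by exists [::]; rewrite ?big_nil. Qed.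

Lemma farD f g : far n f -> far n g -> far n (f + g).
Proof.
by move=> [s sP ->] [t tP ->]; exists (s ++ t); rewrite ?all_cat ?sP ?big_cat.
Qed.

Lemma farMz f c : far n f -> far n (f *~ c).
Proof.
move=> [s sP ->]; exists [seq (p.1 * c, p.2) | p <- s]; first by rewrite all_map.
rewrite big_map mulrz_suml; apply: eq_bigr => p _; by rewrite mulrzA.
Qed.

Lemma farN f : far n f -> far n (- f).
Proof. by rewrite -mulrN1z; exact: farMz. Qed.

Lemma farB f g : far n f -> far n g -> far n (f - g).
Proof. by move=> ff /farN; exact: farD. Qed.

Lemma far_sum (I : eqType) (r : seq I) (P : pred I) F :
  (forall i, i \in r -> P i -> far n (F i)) -> far n (\sum_(i <- r | P i) F i).
Proof.
move=> H; rewrite big_seq_cond; elim/big_ind: _ => //; [exact: far0|exact: farD|].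
by move=> i /andP[]; exact: H.
Qed.

Lemma far_schur w : count_mem true w = k -> (n <= size w)%N ->
  has id (take (size w - n) w) -> far n (schur_string w).
Proof.
move=> cw sw hw; exists [:: (1, w)]; last by rewrite big_seq1.
by rewrite /= cw eqxx sw hw.
Qed.

Lemma addstrip_take (S : comNzRingType) (u : S) w w' d : addstrip u false w w' != 0 ->
  has id (take d w) -> has id (take d w').
Proof.
rewrite /addstrip; elim: w w' d => [|a w IH] [|b w'] [|d] //=; rewrite ?eqxx //.
case: b => //=; case: a => /=; rewrite big_bool /= ?mul0r ?add0r ?eqxx // => H.
by apply: IH; apply: contraNneq H => ->; rewrite mulr0.
Qed.

Lemma ecoef_shift N l d : ecoef (N + d).+1 (l + d) = ecoef N.+1 l.
Proof.
rewrite /ecoef !coefXnM (_ : (k + (l + d) < (N + d).+1)%N = (k + l < N.+1)%N); last by lia.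
by case: ifP => // _; congr (_`_ _); lia.
Qed.

(** Adding boxes only moves 1s to the left, so a shape outside the rectangle stays outside. The
    strings in a [far] element have different lengths; [ecoef_shift] expresses the same polynomial
    for each length. *)
Lemma far_ecoef f l : far n f -> far n (ecoef n.+1 l * f).
Proof.
move=> [s /allP sP ->]; rewrite mulr_sumr;
  apply: far_sum => -[c w] /sP /= /and3P[/eqP cw nw hw] _.
rewrite mulrzAr; apply: farMz.
rewrite -(ecoef_shift n l (size w - n)) subnKC // pieri_coef //.
apply: far_sum => w' _ _;
  have [->|nz] := eqVneq (addcoef (l + (size w - n)) false (false :: w) w') 0.
  by rewrite mulr0z; exact: far0.
apply: farMz; have [cw' sw'] := addstrip_count (addcoef_addstrip nz).
apply: far_schur; first by move: cw'; rewrite addn0 => ->.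
  by rewrite sw'; exact: leqW.
rewrite sw' /= subSn //; apply: (addstrip_take (addcoef_addstrip nz)).
by rewrite /= hw.
Qed.

Lemma addcoef_false_false l w w' :
  addcoef l.+1 false (false :: w) (false :: w') = addcoef l false w w'.
Proof. by rewrite addcoef_cons big_bool /= mul0r coef0 add0r addcoefXS. Qed.

(** Of the strings of length n + 1 in Pieri's rule, those beginning with 0 are the strings of length
    n, and those beginning with 1 have outgrown the rectangle. *)
Lemma pieri_far u l : size u = n -> count_mem true u = k ->
  far n (ecoef n.+1 l.+1 * schur_string u
         - \sum_(u' <- words bool n) schur_string u' *~ addcoef l false u u').
Proof.
move=> su cu; have := @pieri_coef u l.+1 cu; rewrite su => ->;
  rewrite big_wordsS big_bool /=.
rewrite [X in _ + X - _](_ : _ = \sum_(u' <- words bool n) schur_string u' *~ addcoef l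
  false u u'); last first.
  by apply: eq_bigr => u' _; rewrite addcoef_false_false.
rewrite addrK; apply: far_sum => w _ _.
have [->|nz] := eqVneq (addcoef l.+1 false (false :: u) (true :: w)) 0.
  by rewrite mulr0z; exact: far0.
apply: farMz; have [cw' sw'] := addstrip_count (addcoef_addstrip nz).
apply: far_schur; first by move: cw'; rewrite addn0 => ->.
  by rewrite sw' /= su.
by rewrite sw' /= su subSn // subnn.
Qed.

(** A leading 0 is already the room that [pieri] has to create, so nothing is lost by keeping the
    length; a 1 written before it would leave a carry that this 0 cannot absorb. *)
Lemma pieri_exact v l : size v = n -> count_mem true v = k ->
  ecoef n.+2 l.+1 * schur_string (false :: v)
  = \sum_(u' <- words bool n.+1) schur_string u' *~ addcoef l false (false :: v) u'.
Proof.
move=> sv cv; have := @pieri_coef (false :: v) l.+1 cv; rewrite [size _]/= sv => ->.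
rewrite big_wordsS big_bool /= big1 ?add0r; last first.
  move=> w _; rewrite addcoef_cons big_bool /= mul1r mul0r coef0 addr0.
  by rewrite -/(addcoef _ _ _ _) addcoef_true_false mulr0z.
by apply: eq_bigr => w _; rewrite addcoef_false_false.
Qed.

End Module.

Lemma puzzles_addcoef n l la mu nu : size la = n -> size mu = n -> size nu = n ->
  \sum_(mu' <- words bool n) addcoef l false mu mu' * (puzzles la mu' nu)%:Z
  = \sum_(nu' <- words bool n) (puzzles la mu nu')%:Z * addcoef l false nu' nu.
Proof.
move=> sl sm sn; have := @puzzles_addstrip _ ('X : {poly int}) la mu nu.
rewrite sl sm sn => /(_ erefl erefl) /(congr1 (fun p : {poly int} => p`_l)).
rewrite !coef_sum => E; apply: etrans (etrans _ E) _.
  by apply: eq_bigr => w _; rewrite -polyC_natr coefMC natz.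
by apply: eq_bigr => w _; rewrite -polyC_natr coefCM natz.
Qed.

Lemma sorted_or_descent (w : seq bool) : w = sort01 w \/
  exists v m, w = v ++ false :: nseq m true /\ has id v.
Proof.
have [m [v [-> vP]]] : exists m v, w = v ++ nseq m true /\ (v == [::] \/ exists v', v
  = rcons v' false).
  elim/last_ind: w => [|w b [m [v [-> vP]]]]; first by exists 0%N, [::]; split => //; left.
  case: b; last by exists 0%N, (rcons (v ++ nseq m true) false); rewrite cats0;
    split => //; right; eexists.
  by exists m.+1, v; split => //; rewrite -addn1 nseqD catA cats1.
case: vP => [/eqP ->|[v' ->]].
  by left; rewrite /sort01 /= !count_nseq mul0n mul1n.
case hv: (has id v'); first by right; exists v', m; rewrite cat_rcons.
left; have -> : v' = nseq (size v') false.
  by apply/all_pred1P; move/negbT: hv; rewrite -all_predC; apply: sub_all => -[].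
rewrite /sort01 cat_rcons !count_cat /= !count_nseq /= !mul0n !mul1n !add0n addn0.
by rewrite nseqD -catA.
Qed.

(** * The product formula modulo [far] *)

Section Product.
Variables (R : comNzRingType) (k : nat) (x : 'I_k -> R).

Lemma schur_puzzles n la mu :
  size la = n -> size mu = n -> count_mem true la = k -> count_mem true mu = k ->
  far x n (schur_string x la * schur_string x mu
     - \sum_(nu <- words bool n | count_mem true nu == k) schur_string x nu *~
       (puzzles la mu nu)%:Z).
Proof.
move=> sl sm cl cm; have [N] := ubnP (bin_val mu); elim: N => // N IH in mu sm cm *.
rewrite ltnS => leN; case: (sorted_or_descent mu) => [Emu|[v [m [Emu hv]]]].
  have Ela : mu = sort01 la.
    rewrite Emu /sort01 cl cm; congr (nseq _ _ ++ _).
    have E (w : seq bool) : count_mem false w = (size w - count_mem true w)%N.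
      by rewrite -(count_predC (pred1 true)) addKn; apply: eq_count => -[].
    by rewrite !E sl sm cl cm.
  have s1 : schur_string x mu = 1.
    rewrite /schur_string Emu /sort01; elim: (count_mem false mu) => // {Emu}.
    have -> : shape_of (nseq 0 false ++ nseq (count_mem true mu) true)
      = nseq (count_mem true mu) 0%N.
      by elim: (count_mem true mu) => //= q ->; rewrite count_nseq mul0n.
    by apply: tableaux_sum_empty => b; have := col_lt b; rewrite nth_nseq; case: ifP.
  rewrite s1 mulr1 Ela big_mkcond (bigD1_seq la) ?words_uniq ?mem_words ?sl //= cl eqxx.
  rewrite puzzles_sorted eqxx big1 ?addr0 ?subrr; first exact: far0.
  by move=> w /negPf wl; rewrite puzzles_sorted (eq_sym la) wl if_same.
case: n sl sm IH => [|n] sl sm IH; first by move: sm; rewrite Emu size_cat addnS.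
(* The strip leading from [mu1] to [mu] has one box for each 1 of v, and l is the length minus that
   number. By [addstrip_lead] every other term of this degree is a smaller string. *)
pose mu1 := false :: v ++ nseq m true; pose l := (m.+1 + count_mem false v)%N.
have sv : size (v ++ nseq m true) = n by move: sm; rewrite Emu !size_cat /= addnS => -[].
have cv : count_mem true (v ++ nseq m true) = k by rewrite -cm Emu !count_cat.
pose D mu' := schur_string x la * schur_string x mu'
     - \sum_(nu <- words bool n.+1 | count_mem true nu == k) schur_string x nu *~
       (puzzles la mu' nu)%:Z.
have lt1 : (bin_val mu1 < bin_val mu)%N.
  have v0 : (0 < bin_val v)%N.
    elim: v hv {Emu mu1 l sv cv} => //= b v IHv /orP[/= ->|/IHv]; last by case: b; lia.
    by rewrite mul1n addn_gt0 expn_gt0.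
  rewrite /mu1 Emu /= mul0n add0n !bin_val_cat /= mul0n add0n ltn_add2r.
  by rewrite ltn_pmul2l // ltn_exp2l.
have F1 : far x n.+1 (D mu1) by apply: IH => //; [rewrite /= sv|exact: leq_trans lt1 leN].
(* Multiplying the error [D mu1] by the elementary symmetric polynomial gives the same combination
   of the errors [D mu'], up to [far]: Pieri is exact at [mu1], holds modulo [far] at each [nu], and
   [puzzles_addcoef] matches the two expansions. *)
have F2 : far x n.+1 (\sum_(mu' <- words bool n.+1) D mu' *~ addcoef l false mu1 mu').
  have -> : \sum_(mu' <- words bool n.+1) D mu' *~ addcoef l false mu1 mu'
    = ecoef x n.+2 l.+1 * D mu1
      + \sum_(nu <- words bool n.+1 | count_mem true nu == k)
         (ecoef x n.+2 l.+1 * schur_string x nu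
           - \sum_(nu' <- words bool n.+1) schur_string x nu' *~ addcoef l false nu nu')
           *~ (puzzles la mu1 nu)%:Z.
    pose X (P : seq bool -> int) := \sum_(nu <- words bool n.+1 | count_mem true nu == k)
      schur_string x nu *~ P nu.
    transitivity (ecoef x n.+2 l.+1 * (schur_string x la * schur_string x mu1)
       - X (fun nu => \sum_(mu' <- words bool n.+1) addcoef l false mu1 mu' *
         (puzzles la mu' nu)%:Z)).
      rewrite mulrCA (@pieri_exact _ _ x n _ _ sv cv) mulr_sumr.
      have -> : X (fun nu => \sum_(mu' <- words bool n.+1) addcoef l false mu1 mu' *
        (puzzles la mu' nu)%:Z)
        = \sum_(mu' <- words bool n.+1)
          (\sum_(nu <- words bool n.+1 | count_mem true nu == k) schur_string x nu *~
          (puzzles la mu' nu)%:Z) *~ addcoef l false mu1 mu'.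
        rewrite /X; under [RHS]eq_bigr => mu' _ do rewrite mulrz_suml.
        rewrite [RHS]exchange_big; apply: eq_bigr => nu _ /=.
        by rewrite mulrz_sumr; apply: eq_bigr => mu' _; rewrite mulrC mulrzA.
      rewrite -sumrB; apply: eq_bigr => mu' _.
      by rewrite /D mulrzBl mulrzAr.
    transitivity (ecoef x n.+2 l.+1 * (schur_string x la * schur_string x mu1)
       - X (fun nu' => \sum_(nu <- words bool n.+1) (puzzles la mu1 nu)%:Z * addcoef l
         false nu nu')).
      congr (_ - _); rewrite /X big_seq_cond [RHS]big_seq_cond; apply: eq_bigr => nu.
      rewrite mem_words => /andP[/eqP sn _]; congr (_ *~ _).
      by apply: puzzles_addcoef => //; rewrite /= sv.
    have -> : X (fun nu' => \sum_(nu <- words bool n.+1) (puzzles la mu1 nu)%:Z * addcoef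
      l false nu nu')
      = \sum_(nu <- words bool n.+1 | count_mem true nu == k)
          (\sum_(nu' <- words bool n.+1) schur_string x nu' *~ addcoef l false nu nu') *~
            (puzzles la mu1 nu)%:Z.
      rewrite /X; under eq_bigr => nu' _ do rewrite mulrz_sumr.
      under [RHS]eq_bigr => nu _ do rewrite mulrz_suml.
      rewrite big_mkcond [RHS]big_mkcond /=.
      transitivity (\sum_(nu' <- words bool n.+1) \sum_(nu <- words bool n.+1)
         (if count_mem true nu == k then schur_string x nu' *~ addcoef l false nu nu' *~
           (puzzles la mu1 nu)%:Z else 0)).
        apply: eq_bigr => nu' _; case: ifP => cn'.
          apply: eq_bigr => nu _; have [->|nz] := eqVneq (addcoef l false nu nu') 0.
            by rewrite mulr0 mulr0z mul0rz if_same.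
          have [cE _] := addstrip_count (addcoef_addstrip nz).
          by rewrite -cE addn0 cn' mulrC mulrzA.
        rewrite big1 // => nu _; case: ifP => // cn.
        have [->|nz] := eqVneq (addcoef l false nu nu') 0; first by rewrite mulr0z mul0rz.
        have [cE _] := addstrip_count (addcoef_addstrip nz).
        by rewrite -cE addn0 cn' in cn.
      rewrite exchange_big; apply: eq_bigr => nu _ /=.
      by case: ifP => // _; rewrite big1.
    rewrite /D mulrBr -addrA; congr (_ + _); rewrite mulr_sumr -sumrN -sumrN -big_split /=.
    apply: eq_bigr => nu _; rewrite mulrzBl mulrzAr; ring.
  apply: farD; first exact: far_ecoef.
  apply: far_sum => nu; rewrite mem_words => /eqP sn /eqP cn.
  by apply: farMz; apply: pieri_far.
rewrite (bigD1_seq mu) ?words_uniq ?mem_words ?sm //= in F2.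
rewrite {2}Emu addstrip_lead_coef mulr1z in F2.
rewrite -[X in far _ _ X](addrK (\sum_(mu' <- words bool n.+1 | mu' != mu) D mu' *~
  addcoef l false mu1 mu')).
apply: farB => //; apply: far_sum => mu'; rewrite mem_words => /eqP sm' ne.
have [->|nz] := eqVneq (addcoef l false mu1 mu') 0; first by rewrite mulr0z; exact: far0.
apply: farMz; have [cm' _] := addstrip_count (addcoef_addstrip nz).
apply: IH => //; first by move: cm'; rewrite addn0 => ->.
case: (addstrip_lead nz) => [E|lt]; first by rewrite E Emu eqxx in ne.
by apply: leq_trans leN; rewrite Emu.
Qed.
End Product.

(** * Linear independence of Schur polynomials *)

(** In the branching rule the lowest power of the last variable is therefore the last part of p, and
    it occurs only for p with that part deleted. *)
Lemma interlacing_last p q : sorted geq p -> q \in interlacing p -> p != [::] ->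
  (sumn q + last 0 p <= sumn p)%N /\
  ((sumn q + last 0 p)%N = sumn p -> q = take (size p).-1 p).
Proof.
elim: p q => // a [|b p] IH q sp.
  by rewrite /interlacing inE => /eqP -> _ /=; rewrite addn0.
rewrite interlacing_cons => /allpairsP[[c q'] /= [Hc Hq ->]] _.
have sp' : sorted geq (b :: p) by move: sp => /= /andP[].
have [le eq] := IH _ sp' Hq isT; move: Hc le eq; rewrite mem_iota /= => Hc le eq.
split; first by lia.
move=> E; have ca : c = a by lia.
by rewrite ca eq //; lia.
Qed.

Lemma take_interlacing p : sorted geq p -> p != [::] -> take (size p).-1 p \in interlacing
  p.
Proof.
move=> sp np; rewrite mem_interlacing // size_take;
  have : (0 < size p)%N by rewrite lt0n size_eq0.
case: (size p) => // n _; rewrite ltnSn eqxx; apply/allP => i;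
  rewrite mem_iota add0n => /andP[_ lt].
by rewrite nth_take // leqnn andbT sorted_nth.
Qed.

Lemma rcons_take p n : size p = n.+1 -> rcons (take n p) (last 0%N p) = p.
Proof.
case/lastP: p => // p a; rewrite size_rcons last_rcons => -[<-].
by rewrite -(cats1 p a) take_size_cat // cats1.
Qed.

Lemma eq_tableaux_sum (R : comNzRingType) K (x y : 'I_K -> R) m p :
  (forall i : 'I_K, (i < m)%N -> x i = y i) -> tableaux_sum x m p = tableaux_sum y m p.
Proof.
move=> E; apply: eq_bigr => T /andP[_ /forallP bT]; apply: eq_bigr => b _.
exact: E.
Qed.

(* Quantifying over all rings allows the last variable to be an indeterminate 'X;
   comparing coefficients of 'X^l isolates the partitions with last part l. *)
Lemma tableaux_sum_indep K m (L : seq (seq nat)) (c : seq nat -> int) :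
  (m <= K)%N -> uniq L -> (forall p, p \in L -> size p = m /\ sorted geq p) ->
  (forall (R : comNzRingType) (x : 'I_K -> R),
     \sum_(p <- L) tableaux_sum x m p *~ c p = 0) ->
  forall p, p \in L -> c p = 0.
Proof.
elim: m L c => [|m IH] L c mK uL sL H p pL.
  have L1 q : q \in L -> q = [::] by move/sL => -[/size0nil].
  have := H int (fun=> 0); rewrite (bigD1_seq p) //= big1_seq; last first.
    by move=> q /andP[qp /L1 E]; move: qp; rewrite E (L1 _ pL) eqxx.
  by rewrite addr0 (L1 _ pL) tableaux_sum_nil intz.
pose i : 'I_K := Ordinal mK.
(* In the coefficient of 'X^l, shapes with a larger last part do not occur, and those with a smaller
   one have coefficient 0 by this inner induction. *)
have [l] := ubnP (last 0%N p); elim: l => // l IHl in p pL *.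
rewrite ltnS leq_eqVlt => /orP[/eqP lp|]; last exact: IHl.
pose L' := [seq take m q | q <- L & last 0%N q == l].
pose c' q := c (rcons q l).
suff : c' (take m p) = 0.
  by rewrite /c' -lp rcons_take //; case: (sL _ pL).
apply: (IH L' c') => //.
- exact: ltnW.
- rewrite map_inj_in_uniq ?filter_uniq // => q r; rewrite !mem_filter.
  move=> /andP[/eqP lq /sL[sq _]] /andP[/eqP lr /sL[sr _]] E.
  by rewrite -(rcons_take sq) -(rcons_take sr) E lq lr.
- move=> q /mapP[r]; rewrite mem_filter => /andP[_ /sL[sr sor]] ->.
  by rewrite size_take sr ltnSn take_sorted.
- move=> R x; pose x' j : {poly R} := if j == i then 'X else (x j)%:P.
  have := congr1 (fun f : {poly R} => f`_l) (H _ x').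
  rewrite coef0 coef_sum; apply: etrans; rewrite /L' big_map big_filter big_mkcond /=.
  apply: eq_big_seq => q qL; have [sq soq] := sL _ qL.
  have nq : q != [::] by rewrite -size_eq0 sq.
  rewrite coefMrz (tableaux_sum_branch x' (m := i)) // coef_sum.
  have E r : ('X^(sumn q - sumn r) * tableaux_sum x' m r)`_l
     = if (sumn q - sumn r)%N == l then tableaux_sum x m r else 0.
    rewrite (@eq_tableaux_sum _ _ x' (fun j => (x j)%:P)); last first.
      by move=> j jm; rewrite /x'; case: eqP => // ji; rewrite ji ltnn in jm.
    rewrite tableaux_sum_rmorph coefXnM coefC subn_eq0.
    by case: ltngtP.
  have x'i : x' i = 'X by rewrite /x' eqxx.
  under eq_bigr => r _ do rewrite x'i E.
  case: ifP => [/eqP lq|/negbT lq].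
    rewrite (bigD1_seq (take m q)) ?interlacing_uniq //=; last first.
      by have := take_interlacing soq nq; rewrite sq.
    have sqE : sumn q = (sumn (take m q) + l)%N.
      by rewrite -{1}(rcons_take sq) lq sumn_rcons.
    rewrite sqE addKn eqxx big1_seq ?addr0 /c' ?(rcons_take sq) -?lq ?rcons_take //.
    move=> r /andP[rq rI]; case: eqP => // Er; case/eqP: rq.
    have [le eq] := interlacing_last soq rI nq.
    by move: eq; rewrite sq /= => -> //; lia.
  case: (ltngtP (last 0%N q) l) lq => // lq _.
    by rewrite IHl ?mulr0z // lq.
  rewrite big1_seq ?mul0rz // => r /andP[_ rI]; case: eqP => // Er.
  have [le _] := interlacing_last soq rI nq; lia.
- by apply/mapP; exists p => //; rewrite mem_filter lp eqxx.
Qed.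

(** * From the product formula to the Littlewood-Richardson coefficients *)

Lemma big_supported (V : nmodType) (I : eqType) (L M : seq I) (F : I -> V) :
  uniq L -> uniq M -> {subset L <= M} -> (forall i, i \notin L -> F i = 0) ->
  \sum_(i <- M) F i = \sum_(i <- L) F i.
Proof.
move=> uL uM sub F0; rewrite (bigID (mem L)) /= [X in _ + X]big1 ?addr0; last exact: F0.
rewrite -big_filter; apply: perm_big; apply: uniq_perm; rewrite ?filter_uniq // => i.
by rewrite mem_filter; apply: andb_idr; exact: sub.
Qed.

Lemma big_regroup (V : zmodType) (I J : eqType) (r : seq I) (P : pred I) (L : seq J)
    (h : I -> J) (G : J -> V) (a : I -> int) :
  uniq L -> (forall i, i \in r -> P i -> h i \in L) ->
  \sum_(i <- r | P i) G (h i) *~ a i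
  = \sum_(p <- L) G p *~ \sum_(i <- r | P i && (h i == p)) a i.
Proof.
move=> uL hL; under [RHS]eq_bigr => p _ do rewrite mulrz_sumr big_mkcond.
rewrite [RHS]exchange_big /= big_mkcond; apply: eq_big_seq => i ir.
case: (boolP (P i)) => Pi /=; last by rewrite big1.
rewrite (bigD1_seq (h i)) ?hL //= eqxx big1 ?addr0 // => p /negPf.
by rewrite eq_sym => ->.
Qed.

Lemma mem_partitions k N p :
  (p \in partitions k N) = [&& size p == k, sorted geq p & sumn p == N].
Proof.
rewrite mem_filter; case sp: (sorted geq p && (sumn p == N)); rewrite ?andbT ?andbF //=.
apply/mapP/eqP => [[t _ ->]|szp]; first by rewrite size_map size_tuple.
have le i : i \in p -> (i < N.+1)%N.
  case/andP: sp => _ /eqP <-; elim: (p) i => // a q IH i; rewrite inE /=.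
  by move=> /orP[/eqP ->|/IH]; lia.
have sz : size [seq (inord i : 'I_N.+1) | i <- p] == k by rewrite size_map szp.
exists (Tuple sz); rewrite ?mem_enum //= -map_comp map_id_in // => i /le lt.
by rewrite /= inordK.
Qed.

Lemma partitions_uniq k N : uniq (partitions k N).
Proof.
rewrite filter_uniq // map_inj_uniq ?enum_uniq //.
by apply: inj_comp; [exact: inj_map val_inj|exact: val_inj].
Qed.

Lemma card_box p : #|{: box p}| = sumn p.
Proof.
rewrite -sum1_card -(@sig_big_dep _ _ _ _ (fun i : 'I_(size p) => 'I_(nth 0%N p i)) xpredT
  (fun _ => xpredT) (fun i j => 1%N)) /=.
by rewrite (sumn_nth erefl); apply: eq_bigr => i _; rewrite sum1_card card_ord.
Qed.

Lemma tableaux_sum_scale (R : comNzRingType) K (x : 'I_K -> R) t m p :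
  tableaux_sum (fun i => x i * t) m p = tableaux_sum x m p * t ^+ sumn p.
Proof.
rewrite /tableaux_sum mulr_suml; apply: eq_bigr => T _.
by rewrite big_split /= prodr_const card_box.
Qed.

Section Eval.
Variables (k : nat).
Local Notation X := (fun i : 'I_k => 'X_i : {mpoly int[k]}).

Lemma schurE sh : schur k sh = tableaux_sum X k sh.
Proof.
apply: eq_bigl => T; rewrite /bounded andbC.
by have -> : [forall b, (T b < k)%N] by apply/forallP.
Qed.

Lemma tableaux_sum_eval (R : comNzRingType) (x : 'I_k -> R) m p :
  mmap intr x (tableaux_sum X m p) = tableaux_sum x m p.
Proof.
rewrite -(tableaux_sum_rmorph (mmap intr x)); apply: eq_bigr => T _; apply: eq_bigr => b _.
by rewrite /= mmapX mmap1U.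
Qed.
End Eval.

Lemma shape_inj w w' : size w = size w' -> shape_of w = shape_of w' -> w = w'.
Proof.
have cnt v : size v = (count_mem true v + count_mem false v)%N.
  by rewrite -(count_predC (pred1 true)); congr addn; apply: eq_count => -[].
have no v v' : size v = size v' -> count_mem false v :: shape_of v = shape_of v' -> False.
  move=> sz E; have := path_shape v'; rewrite -E /= => /andP[le _].
  have := congr1 size E; rewrite /= !size_shape => c.
  have {}le : (count_mem false v <= count_mem false v')%N := le.
  by move: sz; rewrite !cnt; lia.
elim: w w' => [|a w IH] [|b w'] //= [sz]; case: a; case: b => //.
- by move=> [_ /(IH _ sz) ->].
- by move/(no _ _ sz).
- by move/esym/(no _ _ (esym sz)).
- by move/(IH _ sz) ->.
Qed.

Lemma shape_nseq0 d w : shape_of (nseq d false ++ w) = shape_of w.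
Proof. by elim: d. Qed.

Lemma LR_puzzles n k la mu nu :
  size la = n -> size mu = n -> size nu = n ->
  count_mem true la = k -> count_mem true mu = k -> count_mem true nu = k ->
  LR la mu nu = (puzzles la mu nu)%:Z.
Proof.
move=> sl sm sn cl cm cn; rewrite /LR cl /LRcoef.
pose X := fun i : 'I_k => 'X_i : {mpoly int[k]}.
have [s /allP sP E] := schur_puzzles X sl sm cl cm.
set N := (sumn (shape_of la) + sumn (shape_of mu))%N.
pose c p : int := \sum_(v <- words bool n | (count_mem true v == k) && (shape_of v == p))
  (puzzles la mu v)%:Z
   + \sum_(e <- s | true && (shape_of e.2 == p)) e.1.
pose M := undup ([seq shape_of v | v <- words bool n & count_mem true v == k]
   ++ [seq shape_of e.2 | e <- s] ++ partitions k N).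
have uM : uniq M by exact: undup_uniq.
have MP p : p \in M -> size p = k /\ sorted geq p.
  rewrite mem_undup !mem_cat => /or3P[/mapP[v]|/mapP[e /sP]|].
  - by rewrite mem_filter => /andP[/eqP cv _] ->; rewrite size_shape sorted_shape.
  - by case/and3P => /eqP ce _ _ ->; rewrite size_shape sorted_shape.
  - by rewrite mem_partitions => /and3P[/eqP].
have EM : schur_string X la * schur_string X mu = \sum_(p <- M) tableaux_sum X k p *~ c p.
  rewrite -[LHS](subrK (\sum_(v <- words bool n | count_mem true v == k) schur_string X v
    *~ (puzzles la mu v)%:Z)).
  rewrite E addrC (@big_regroup _ _ _ _ _ M shape_of (tableaux_sum X k)) //; last first.
    by move=> v vn cv; rewrite mem_undup mem_cat map_f // mem_filter cv.
  rewrite (@big_regroup _ _ _ _ _ M (fun e => shape_of e.2) (tableaux_sum X k)) //;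
    last first.
    by move=> e es _; rewrite mem_undup !mem_cat (map_f (fun e => shape_of e.2)) // orbT.
  by rewrite -big_split; apply: eq_bigr => p _ /=; rewrite mulrzDr.
(* The identity for indeterminates is specialised to every ring, the form in which both the degree
   argument and [tableaux_sum_indep] use it. *)
have Eeval (R : comNzRingType) (x : 'I_k -> R) :
    schur_string x la * schur_string x mu = \sum_(p <- M) tableaux_sum x k p *~ c p.
  have := congr1 (mmap intr x) EM; rewrite rmorphM /= !tableaux_sum_eval => ->.
  rewrite rmorph_sum; apply: eq_bigr => p _.
  by rewrite /= rmorphMz /= tableaux_sum_eval.
(* The [far] remainder may contain shapes of any size. Scaling all variables by 'X and taking the
   coefficient of 'X^N keeps only the shapes of size N, as [partitions k N] demands. *)
have Ehom : schur_string X la * schur_string X mu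
  = \sum_(p <- M | sumn p == N) tableaux_sum X k p *~ c p.
  have := Eeval _ (fun i => (X i)%:P * 'X).
  rewrite /schur_string !tableaux_sum_scale !tableaux_sum_rmorph mulrACA -exprD -/N
    -rmorphM /=.
  move/(congr1 (fun f : {poly _} => f`_N)); rewrite coefMXn ltnn subnn coefC eqxx => ->.
  rewrite coef_sum [RHS]big_mkcond; apply: eq_bigr => p _.
  rewrite tableaux_sum_scale tableaux_sum_rmorph coefMrz coefMXn coefC subn_eq0.
  by case: ltngtP; rewrite ?mul0rz.
(* The choice operator satisfies its specification only once some expansion is known to exist. *)
have Hd : exists d, schur_product_expansion k (shape_of la) (shape_of mu) d.
  exists (fun p => if p \in partitions k N then c p else 0); split.
    by move=> p /negPf ->.
  rewrite !schurE Ehom.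
  rewrite -/N big_mkcond.
  transitivity (\sum_(p <- M) tableaux_sum X k p *~ (if p \in partitions k N then c p else
    0)).
    apply: eq_big_seq => p /MP[sp sop]; rewrite mem_partitions sp sop eqxx /=.
    by case: ifP.
  rewrite (@big_supported _ _ (partitions k N)) ?partitions_uniq //.
  - apply: eq_bigr => p _; rewrite schurE.
    by rewrite -scaler_int intz.
  - by move=> p pp; rewrite mem_undup !mem_cat pp !orbT.
  - by move=> p /negPf ->; rewrite mulr0z.
have := epsilon_spec (inhabits (fun _ : seq nat => 0))
  (schur_product_expansion k (shape_of la) (shape_of mu)) Hd.
set c' := epsilon _ _ => -[c'0 c'E].
have nuM : shape_of nu \in M.
  by rewrite mem_undup mem_cat map_f // mem_filter cn eqxx mem_words sn /=.
have /eqP : c' (shape_of nu) - c (shape_of nu) = 0.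
  apply: (@tableaux_sum_indep k k M (fun p => c' p - c p)) => // R x.
  have E2 : schur_string x la * schur_string x mu = \sum_(p <- M) tableaux_sum x k p *~ c'
    p.
    have := congr1 (mmap intr x) c'E.
    rewrite !schurE rmorphM /= !tableaux_sum_eval => ->.
    rewrite rmorph_sum /= [RHS](@big_supported _ _ (partitions k N)) ?partitions_uniq //.
    - apply: eq_bigr => p _;
      rewrite schurE -[c' p]intz scaler_int rmorphMz /= tableaux_sum_eval.
      by rewrite intz.
    - by move=> p pp; rewrite mem_undup !mem_cat pp !orbT.
    - by move=> p /c'0 ->; rewrite mulr0z.
  under eq_bigr => p _ do rewrite mulrzBr.
  by rewrite sumrB -E2 -Eeval subrr.
rewrite subr_eq0 => /eqP ->; rewrite /c.
(* The remainder does not contribute at [nu]: a longer string with the shape of [nu] is [nu] padded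
   with 0s on the left, so it has no 1 among its extra letters. *)
rewrite [X in _ + X]big1_seq ?addr0; last first.
  move=> [z w] /= /andP[/eqP Ew /sP /= /and3P[/eqP cw sw hw]].
  suff Ew2 : w = nseq (size w - n) false ++ nu.
    by move: hw; rewrite Ew2 take_size_cat ?size_nseq ?has_nseq ?andbF //;
      rewrite size_cat size_nseq sn addnK.
  apply: shape_inj; first by rewrite size_cat size_nseq sn subnK.
  by rewrite shape_nseq0.
rewrite big_mkcond (bigD1_seq nu) ?words_uniq ?mem_words ?sn //= cn !eqxx /=.
rewrite big1_seq ?addr0 // => v /andP[vn]; rewrite mem_words => /eqP sv.
case: ifP => // /andP[_ /eqP Ev]; case/eqP: vn; apply: shape_inj => //.
by rewrite sv sn.
Qed.

Local Close Scope ring_scope.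
Unset Implicit Arguments.

Theorem proposition10
  (a0 a1 b0 b1 c0 c1 d0 d1 e0 e1 z0 z1 : nat)
  (hbc0 : b0 + c0 = e0 + z0) (hab0 : a0 + b0 = d0 + e0) (hcd0 : c0 + d0 = z0 + a0)
  (hbc1 : b1 + c1 = e1 + z1) (hab1 : a1 + b1 = d1 + e1) (hcd1 : c1 + d1 = z1 + a1)
  (alpha beta gamma delta eps zeta : seq bool)
  (halpha : alpha \in strings (a0 + a1) a1)
  (hbeta : beta \in strings (b0 + b1) b1)
  (hgamma : gamma \in strings (c0 + c1) c1)
  (hdelta : delta \in strings (d0 + d1) d1)
  (heps : eps \in strings (e0 + e1) e1)
  (hzeta : zeta \in strings (z0 + z1) z1) :
  LR (sort01 alpha ++ beta ++ gamma)
     (sort01 gamma ++ delta ++ sort01 eps)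
     (rev (eps ++ zeta ++ alpha))
  = LR (sort01 delta ++ eps ++ zeta)
       (sort01 zeta ++ alpha ++ sort01 beta)
       (rev (beta ++ gamma ++ delta)).
Proof.
move: halpha hbeta hgamma hdelta heps hzeta; rewrite !inE.
move=> /andP[/eqP sa /eqP ca] /andP[/eqP sb /eqP cb] /andP[/eqP sc /eqP cc].
move=> /andP[/eqP sd /eqP cd] /andP[/eqP se /eqP ce] /andP[/eqP sz /eqP cz].
have count_sort01 w : count_mem true (sort01 w) = count_mem true w.
  by rewrite count_cat !count_nseq mul0n mul1n.
pose E := (size_sort01, count_sort01, size_rev, count_rev, size_cat, count_cat,
  (sa, sb, sc, sd, se, sz), (ca, cb, cc, cd, ce, cz)).
rewrite (@LR_puzzles (size (sort01 alpha ++ beta ++ gamma)) (a1 + b1 + c1));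
  try by rewrite !E; lia.
rewrite (@LR_puzzles (size (sort01 delta ++ eps ++ zeta)) (d1 + e1 + z1));
  try by rewrite !E; lia.
rewrite (@puzzles_hexagon alpha); last by rewrite !E; lia.
rewrite (@puzzles_hexagon delta); last by rewrite !E; lia.
by congr Posz; apply: hexagon_rev; rewrite !E; lia.
Qed.
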